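(* Let $\mathcal{S}=(\mathbb{E},\mathbb{E}_\vee,\mathbb{E}_<,\Gamma)$ be a Euclidean cut and project scheme with (possibly multi-coloured) window $W$, and let $L\colon \mathbb{E}_\vee\to\mathbb{E}_\vee$ be a linear automorphism. The cut and project sets in $\Omega(\mathcal{S},W)$ are all $L$-Sub if and only if there is a linear map $M\colon\mathbb{E}\to\mathbb{E}$ satisfying the following: (1) $M(\Gamma)=\Gamma$; (2) $M(\mathbb{E}_\vee)=\mathbb{E}_\vee$ with $L=M|_{\mathbb{E}_\vee}$; (3) $M(\mathbb{E}_<)=\mathbb{E}_<$, and we define $A:=M|_{\mathbb{E}_<}$; (4) a translate $W-s$ of $W$, for some $s\in\mathbb{E}_<$, is mutually constructable from $A(W)$. If $L$ is expansive, then $A=M|_{\mathbb{E}_<}$ is contractive (for any such $M$), and the equivalence remains true with (4) replaced by the weaker condition (4a) a translate $W-s$ of $W$, for some $s\in\mathbb{E}_<$, is constructable from $A(W)$.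
   Context: **Patterns.** A Delone multiset in a finite-dimensional real normed space $E$ is a tuple $\Lambda=(\Lambda_1,\dots,\Lambda_\ell)$ of subsets of $E$ whose union $\mathrm{supp}(\Lambda)$ is uniformly discrete and relatively dense (a Delone set when $\ell=1$). Translates $\Lambda+x$ and linear images $L\Lambda$ are taken componentwise. A patch of $\Lambda$ is a tuple $(\Lambda_i\cap U)_i$ with $U\subset E$ bounded. With $B(x,r)$ the closed ball, $\Lambda[x,r]:=((\Lambda_i\cap B(x,r))-x)_i$. $\mathcal{Q}$ is locally derivable (LD) from $\mathcal{P}$ if there is $c\ge0$ such that for all $x,y\in E$, $\mathcal{P}[x,c]=\mathcal{P}[y,c]$ implies $\mathcal{Q}[x,0]=\mathcal{Q}[y,0]$; they are MLD if each is LD from the other. $\mathcal{P}$ is locally indistinguishable (LI) from $\mathcal{Q}$ if every patch of $\mathcal{P}$ occurs, up to translation, in $\mathcal{Q}$; they are locally isomorphic if each is LI from the other. The hull $\Omega_{\mathcal{P}}$ is the set of all patterns LI from $\mathcal{P}$. For a linear automorphism $L$ of $E$, $\mathcal{P}$ is $L$-Sub (strongly $L$-substitutional) if there is a pattern $\mathcal{P}'$, locally isomorphic to $\mathcal{P}$, with $L\mathcal{P}'$ and $\mathcal{P}$ MLD. A linear map is expansive (contractive) if all its eigenvalues have modulus strictly greater (less) than $1$. **Cut and project.** A Euclidean cut and project scheme $\mathcal{S}=(\mathbb{E},\mathbb{E}_\vee,\mathbb{E}_<,\Gamma)$ consists of a $k$-dimensional real vector space $\mathbb{E}$, complementary subspaces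 $\mathbb{E}_\vee$ (physical) of dimension $d>0$ and $\mathbb{E}_<$ (internal) of dimension $n=k-d>0$, and a full rank lattice $\Gamma\subset\mathbb{E}$. Let $\pi_\vee,\pi_<$ be the projections to $\mathbb{E}_\vee,\mathbb{E}_<$ along the decomposition $\mathbb{E}=\mathbb{E}_\vee\oplus\mathbb{E}_<$, and write $x_\vee=\pi_\vee(x)$, $x_<=\pi_<(x)$ (similarly for sets). It is required that $\pi_\vee|_\Gamma$ and $\pi_<|_\Gamma$ are injective and $\Gamma_<$ is dense in $\mathbb{E}_<$. A window is a finite tuple $W=(W_i)_{i=1}^\ell$ of compact, topologically regular (equal to the closure of their interior) subsets of $\mathbb{E}_<$, not all empty; $W+s=(W_i+s)_i$, $A(W)=(A(W_i))_i$. It is in non-singular position if $\Gamma_<\cap\partial W_i=\emptyset$ for all $i$; then $\Lambda(\mathcal{S},W)=(\Lambda_i)_i$ with $\Lambda_i=\{\gamma_\vee:\gamma\in\Gamma,\ \gamma_<\in W_i\}$, a Delone multiset in $\mathbb{E}_\vee$. For arbitrary $W$, $\Omega(\mathcal{S},W):=\Omega_{\Lambda(\mathcal{S},W+s)}$ for any $s\in\mathbb{E}_<$ with $W+s$ non-singular (independent of $s$). **Constructability.** Let $\mathscr{B}$ be the set of topologically regular subsets of $\mathbb{E}_<$, a Boolean algebra with $U\wedge V=\mathrm{cl}(\mathrm{int}(U\cap V))$, $U\vee V=\mathrm{cl}(\mathrm{int}(U\cup V))$, $\neg U=\mathrm{cl}(\mathrm{int}(\mathbb{E}_<\setminus U))$.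 $\mathscr{B}(W)$ is the Boolean subalgebra generated by all $W_i+g$, $g\in\Gamma_<$. $W'$ is constructable from $W$ if $\mathscr{B}(W')\subseteq\mathscr{B}(W)$; mutually constructable if $\mathscr{B}(W')=\mathscr{B}(W)$. *)

(* Defs.v *)
From HB Require Import structures.
From mathcomp Require Import all_boot all_order all_algebra.
From mathcomp Require Import all_classical all_reals all_analysis.
From mathcomp Require Import complex.

Set Implicit Arguments.
Unset Strict Implicit.
Unset Printing Implicit Defensive.

Import Order.TTheory GRing.Theory Num.Theory.
Import numFieldNormedType.Exports.

Local Open Scope classical_set_scope.
Local Open Scope ring_scope.

#[short(type="normedVectType")]
HB.structure Definition NormedVector (K : numFieldType) :=
  {V of NormedModule K V & Vector K V}.

HB.instance Definition _ (K : numFieldType) m n := Vector.on 'M[K]_(m, n).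

Section SubspaceNorm.
Context (K : numFieldType) (E : normedVectType K) (U : {vspace E}).

Let norm (u : subvs_of U) : K := `|vsval u|.

Let norm_triangle (u v : subvs_of U) : norm (u + v) <= norm u + norm v.
Proof. exact: ler_normD. Qed.

Let norm_scale (a : K) (u : subvs_of U) : norm (a *: u) = `|a| * norm u.
Proof. exact: normrZ. Qed.

Let norm_eq0 (u : subvs_of U) : norm u = 0 -> u = 0.
Proof. by move=> /normr0_eq0 u0; apply: val_inj; rewrite /= u0. Qed.

HB.instance Definition _ := Lmodule_isNormed.Build K (subvs_of U)
  norm_triangle norm_scale norm_eq0.

End SubspaceNorm.

Section Sets.
Context (R : realType) (E : normedVectType R).

Definition translate (t : E) (A : set E) : set E := [set y + t | y in A].

Definition boundary (A : set E) : set E := closure A `\` A°.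

Definition uniformly_discrete (A : set E) :=
  exists2 r : R, 0 < r &
    forall x y, A x -> A y -> x != y -> r <= `|x - y|.

Definition relatively_dense (A : set E) :=
  exists r : R, forall x, exists2 y, A y & `|x - y| <= r.

End Sets.

Section Patterns.
Context (R : realType) (E : normedVectType R).

Definition support l (P : 'I_l -> set E) : set E := \bigcup_i P i.

Definition delone l (P : 'I_l -> set E) :=
  uniformly_discrete (support P) /\ relatively_dense (support P).

Definition image_pattern (L : 'End(E)) l (P : 'I_l -> set E) : 'I_l -> set E :=
  fun i => L @` P i.

Definition patch l (P : 'I_l -> set E) (U : set E) : 'I_l -> set E :=
  fun i => P i `&` U.

(* P[x, r].  The library's [closed_ball x r] is the closure of an open ball,
   hence empty for r = 0; [closed_ball_ Num.norm x 0] is [set x]. *)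
Definition local_patch l (P : 'I_l -> set E) (x : E) (r : R) : 'I_l -> set E :=
  fun i => translate (- x) (P i `&` closed_ball_ Num.norm x r).

Definition locally_derivable l m (Q : 'I_m -> set E) (P : 'I_l -> set E) :=
  exists2 c : R, 0 <= c &
    forall x y : E, local_patch P x c = local_patch P y c ->
                    local_patch Q x 0 = local_patch Q y 0.

Definition MLD l m (P : 'I_l -> set E) (Q : 'I_m -> set E) :=
  locally_derivable P Q /\ locally_derivable Q P.

(* An occurrence of the patch of P over U in Q is a translate of it that is
   exactly what Q shows over the same translate of U. *)
Definition LI_from l (P Q : 'I_l -> set E) :=
  forall U : set E, bounded_set U ->
    exists t : E, patch Q (translate t U) = fun i => translate t (patch P U i).

Definition locally_isomorphic l (P Q : 'I_l -> set E) :=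
  LI_from P Q /\ LI_from Q P.

Definition hull l (P : 'I_l -> set E) : set ('I_l -> set E) :=
  [set Q | delone Q /\ LI_from Q P].

Definition LSub (L : 'End(E)) l (P : 'I_l -> set E) :=
  exists P' : 'I_l -> set E,
    [/\ delone P', locally_isomorphic P' P & MLD (image_pattern L P') P].

End Patterns.

Section Eigenvalues.
Context (R : realType) (V : vectType R).

(* Eigenvalues of a real map are taken in R[i]; mxof acts on row vectors, as does
   mxalgebra's [eigenvalue]. *)
Definition complex_eigenvalue (f : 'End(V)) (z : R[i]) : bool :=
  eigenvalue (map_mx (real_complex R) (passmx.mxof (vbasis {:V}) (vbasis {:V}) f)) z.

Definition expansive (f : 'End(V)) :=
  forall z : R[i], complex_eigenvalue f z -> 1 < `|z|.

Definition contractive (f : 'End(V)) :=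
  forall z : R[i], complex_eigenvalue f z -> `|z| < 1.

End Eigenvalues.

Section Restriction.
Context (R : realType) (E : vectType R).

(* This is M|_U only when M maps U into U; otherwise [vsproj] composes with a
   projection onto U. *)
Definition restrict_end (M : 'End(E)) (U : {vspace E}) : 'End(subvs_of U) :=
  linfun (vsproj U \o M \o vsval).

End Restriction.

Definition full_rank_lattice (R : realType) (E : vectType R) (G : set E) :=
  exists2 b : (\dim {:E}).-tuple E, basis_of {:E} b &
    G = [set v | inIntSpan b v].

Section Projections.
Context (R : realType) (E : vectType R).

(* The projection of E onto U along U', valued in the space U itself. *)
Definition proj_along (U U' : {vspace E}) (x : E) : subvs_of U :=
  vsproj U (daddv_pi U U' x).

End Projections.

Record cut_project_scheme (R : realType) (E : normedVectType R) := CPS {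
  phys : {vspace E};
  intl : {vspace E};
  lat : set E;
  phys_gt0 : (0 < \dim phys)%N;
  intl_gt0 : (0 < \dim intl)%N;
  cps_cap : (phys :&: intl = 0)%VS;
  cps_add : (phys + intl = {:E})%VS;
  lat_full : full_rank_lattice lat;
  phys_inj : {in lat &, injective (proj_along phys intl)};
  intl_inj : {in lat &, injective (proj_along intl phys)};
  intl_dense : dense (proj_along intl phys @` lat)
}.

Section CutAndProject.
Context (R : realType) (E : normedVectType R) (S : cut_project_scheme E).

Definition pi_phys : E -> subvs_of (phys S) := proj_along (phys S) (intl S).

Definition pi_intl : E -> subvs_of (intl S) := proj_along (intl S) (phys S).

Definition lat_intl : set (subvs_of (intl S)) := pi_intl @` lat S.

Definition is_window l (W : 'I_l -> set (subvs_of (intl S))) :=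
  [/\ forall i, compact (W i), forall i, regclosed (W i)
    & exists i, W i !=set0].

Definition shift_window l (s : subvs_of (intl S))
    (W : 'I_l -> set (subvs_of (intl S))) : 'I_l -> set (subvs_of (intl S)) :=
  fun i => translate s (W i).

Definition image_window (A : 'End(subvs_of (intl S))) l
    (W : 'I_l -> set (subvs_of (intl S))) : 'I_l -> set (subvs_of (intl S)) :=
  fun i => A @` W i.

Definition nonsingular l (W : 'I_l -> set (subvs_of (intl S))) :=
  forall i, lat_intl `&` boundary (W i) = set0.

Definition cp_pattern l (W : 'I_l -> set (subvs_of (intl S))) :
    'I_l -> set (subvs_of (phys S)) :=
  fun i => pi_phys @` [set g | lat S g /\ W i (pi_intl g)].

(* The hull of the pattern of W + s does not depend on the non-singular s, so
   the union over all such s is that common hull. *)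
Definition cp_hull l (W : 'I_l -> set (subvs_of (intl S))) :
    set ('I_l -> set (subvs_of (phys S))) :=
  [set P | exists2 s, nonsingular (shift_window s W)
                    & hull (cp_pattern (shift_window s W)) P].

Definition reg_meet (U V : set (subvs_of (intl S))) := closure (U `&` V)°.

Definition reg_join (U V : set (subvs_of (intl S))) := closure (U `|` V)°.

Definition reg_compl (U : set (subvs_of (intl S))) := closure (~` U)°.

Definition boolean_subalgebra (F : set (set (subvs_of (intl S)))) :=
  [/\ F `<=` [set U | regclosed U], F set0 /\ F setT,
      forall U V, F U -> F V -> F (reg_meet U V),
      forall U V, F U -> F V -> F (reg_join U V)
    & forall U, F U -> F (reg_compl U)].

Definition window_algebra l (W : 'I_l -> set (subvs_of (intl S))) :
    set (set (subvs_of (intl S))) :=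
  smallest boolean_subalgebra
    [set U | exists i, exists2 g, lat_intl g & U = translate g (W i)].

Definition constructable_from l m (W' : 'I_l -> set (subvs_of (intl S)))
    (W : 'I_m -> set (subvs_of (intl S))) :=
  window_algebra W' `<=` window_algebra W.

Definition mutually_constructable l m (W' : 'I_l -> set (subvs_of (intl S)))
    (W : 'I_m -> set (subvs_of (intl S))) :=
  window_algebra W' = window_algebra W.

Definition scheme_extension (L : 'End(subvs_of (phys S))) (M : 'End(E)) :=
  [/\ M @` lat S = lat S,
      (M @: phys S)%VS = phys S /\ L = restrict_end M (phys S)
    & (M @: intl S)%VS = intl S].

End CutAndProject.

(* Main.v *)
(* A patch of radius c of a cut and project pattern at a lattice point x records
   which of finitely many translates of the window contain the internal
   coordinate of x.  So a pattern with window W' is locally derivable from one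
   with window W exactly when W' is a Boolean combination of lattice translates
   of W; for a non-singular parameter the lattice never meets the boundaries, and
   regularised and set-theoretic operations agree on it.

   If all patterns of the hull are L-Sub, return vectors of a pattern P generate
   the physical projection of the lattice, and MLD of LP' and P forces L to
   permute that projection.  Hence L lifts to a lattice automorphism M; the
   off-diagonal part of M from physical to internal space is bounded on a
   relatively dense set, so it vanishes.  A compactness argument squeezes P'
   between the open and the closed version of a translated window, and MLD then
   becomes mutual constructability.  The converse transports a local derivation
   between two cut and project patterns to any pattern of the hull.

   If L expands and W - s is constructable from AW, iterating the derivation
   shows that lattice vectors with small internal part, once inflated k times,
   are return vectors on balls of radius tending to infinity; so A^k tends to 0.
   The pairs of patches whose k-fold derived patterns agree far around increase
   with k inside a fixed finite set, so two consecutive levels show the same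
   pairs; there the derivation is invertible, and rescaling inverts the first
   one, which upgrades (4a) to (4). *)

Require Import Defs.
From HB Require Import structures.
From mathcomp Require Import all_boot all_order all_algebra.
From mathcomp Require Import all_classical all_reals all_analysis.
From mathcomp Require Import complex.
From mathcomp Require Import lra ring zify.

Set Implicit Arguments.
Unset Strict Implicit.
Unset Printing Implicit Defensive.

Import Order.TTheory GRing.Theory Num.Theory.
Import numFieldNormedType.Exports.
Import passmx.

Local Open Scope classical_set_scope.
Local Open Scope ring_scope.

(** * Finite-dimensional normed spaces *)

Lemma bounded_setP (R : realType) (V : normedModType R) (A : set V) :
  bounded_set A <-> exists r, forall x, A x -> `|x| <= r.
Proof.
split=> [[M [_ HM]]|[r Ar]].
  by exists (M + 1) => x; apply: HM; rewrite ltrDl.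
by exists r; split=> [|r' /ltW rr' x /Ar /le_trans]; [exact: num_real|exact].
Qed.

Lemma finite_family_bounded (R : realType) (V : normedModType R) l (W : 'I_l -> set V) :
  (forall i, bounded_set (W i)) ->
  exists2 w : R, 0 <= w & forall i x, W i x -> `|x| <= w.
Proof.
move=> bW; pose w i := sval (cid ((bounded_setP (W i)).1 (bW i))).
exists (\big[Num.max/0]_i w i); first exact: bigmax_ge_id.
move=> i x Wx; apply: (le_trans (svalP (cid ((bounded_setP (W i)).1 (bW i))) x Wx)).
exact: (le_bigmax _ w i).
Qed.

Lemma compact_seq_cluster (T : topologicalType) (A : set T) (u : nat -> T) :
  compact A -> (forall n, A (u n)) ->
  exists x : T, forall (B : set T) m, nbhs x B -> exists2 n, (m <= n)%N & B (u n).
Proof.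
move=> cA Au; have [|x [_ clx]] := cA (u @ \oo) _; first by exists 0%N => // n _; exact: Au.
exists x => B m xB; have [|y [[n mn <-] By]] := clx (u @` [set n | (m <= n)%N]) B _ xB.
  by exists m => // n mn; exists n.
by exists n.
Qed.

Lemma finite_set_pos_bound (R : realType) (T : Type) (A : set T) (P : R -> T -> Prop) :
  finite_set A -> (forall t e e', P e t -> e' <= e -> P e' t) ->
  (forall t, A t -> exists2 e, 0 < e & P e t) ->
  exists2 e : R, 0 < e & forall t, A t -> P e t.
Proof.
move=> fA Pmon; have [A0|/set0P[t0 At0]] := eqVneq A set0.
  by exists 1 => // t; rewrite A0.
have {fA} [s sA] : exists s : seq {classic T}, A = [set` s] by exact/finite_seqP.
rewrite sA; elim: s {sA t0 At0} => [|t s IH] h; first by exists 1.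
have [|e e0 he] := IH; first by move=> t' t's; apply: h; rewrite /= inE t's orbT.
have [|e' e'0 he'] := h t; first by rewrite /= inE eqxx.
exists (Num.min e e'); first by rewrite lt_min e0.
move=> t' /=; rewrite inE => /predU1P[->|/he]; [apply: Pmon he' _|move/Pmon; apply].
  by rewrite ge_min lexx orbT.
by rewrite ge_min lexx.
Qed.

Lemma bounded_linear_eq0 (R : realType) (U U' : normedModType R) (f : {linear U -> U'}) (k : R) :
  (forall x, `|f x| <= k) -> forall x, f x = 0.
Proof.
move=> fk x; apply/eqP; rewrite -normr_le0 leNgt; apply/negP => fx0.
have := fk ((Num.truncn (k / `|f x|)).+1%:R *: x).
rewrite linearZ normrZ normr_nat -ler_pdivlMr// leNgt.
by rewrite truncnS_gt.
Qed.

Section RowVectors.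
Context (R : realType) (W : normedModType R).

Lemma row_linear_bounded n (f : {linear 'rV[R]_n -> W}) :
  exists2 C, 0 <= C & forall u, `|f u| <= C * `|u|.
Proof.
exists (\sum_(i < n) `|f (delta_mx 0 i)|); first by rewrite sumr_ge0.
move=> u; rewrite [in leLHS](row_sum_delta u) linear_sum mulr_suml.
apply: (le_trans (ler_norm_sum _ _ _)); apply: ler_sum => i _.
rewrite linearZ normrZ mulrC ler_wpM2l//.
rewrite [leRHS]mx_normrE.
exact: (le_bigmax _ (fun ij : 'I_1 * 'I_n => `|u ij.1 ij.2|) (0, i)).
Qed.

Lemma bounded_lin_continuous (V : normedModType R) (f : {linear V -> W}) C :
  (forall u, `|f u| <= C * `|u|) -> continuous f.
Proof.
move=> fC; apply: bounded_linear_continuous; apply/linear_boundedP.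
near=> r => x; apply: (le_trans (fC x)); apply: ler_wpM2r => //.
Unshelve. all: by end_near. Qed.

End RowVectors.

(** With this, row vectors form a complete normed module, as the Baire category theorem requires. *)
HB.instance Definition _ (R : realType) m n := Complete.on 'M[R]_(m, n).

Section FiniteDim.
Context (R : realType) (V : normedVectType R).

Let n : nat := \dim {:V}.
Let b : n.-tuple V := vbasis {:V}.
Let bP : basis_of {:V} b. Proof. exact: vbasisP. Qed.
Let row_vec : {linear 'rV[R]_n -> V} := passmx.vecof b.
Let vec_row : {linear V -> 'rV[R]_n} := passmx.rVof b.
Let row_vecK : cancel row_vec vec_row. Proof. exact: passmx.vecofK. Qed.
Let vec_rowK : cancel vec_row row_vec. Proof. exact: passmx.rVofK. Qed.
Let row_vec_inj : injective row_vec. Proof. exact: can_inj row_vecK. Qed.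
Let vec_row_inj : injective vec_row. Proof. exact: can_inj vec_rowK. Qed.

Lemma row_vec_bounded : exists2 C, 0 <= C & forall u : 'rV[R]_n, `|row_vec u : V| <= C * `|u|.
Proof. exact: row_linear_bounded. Qed.

Lemma row_vec_continuous : continuous row_vec.
Proof. by have [C _ /bounded_lin_continuous] := row_vec_bounded. Qed.

(* The norm of V attains a positive minimum on the compact unit sphere of the
   coordinate space. *)
Lemma vec_row_bounded : exists2 C, 0 <= C & forall x : V, `|vec_row x| <= C * `|x|.
Proof.
pose S : set 'rV[R]_n := [set u | `|u| = 1].
have cS : compact S.
  apply: bounded_closed_compact.
    by apply/bounded_setP; exists 1 => u /= ->.
  have -> : S = (fun u : 'rV[R]_n => `|u|) @^-1` [set 1] by [].
  by apply: closed_comp => [u _|]; [exact: norm_continuous|exact: closed_eq].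
(* An empty unit sphere forces every coordinate vector to be zero, so the constant 0 works. *)
have [S0|/set0P/negP/negPn/eqP S0] := pselect (S !=set0); last first.
  exists 0 => // x; rewrite mul0r normr_le0; apply: contrapT => /negP x0.
  have : S (`|vec_row x|^-1 *: vec_row x) by exact: normfZV.
  by rewrite S0.
have cf : {within S, continuous (fun u : 'rV[R]_n => `|row_vec u : V| : R)}.
  apply: continuous_subspaceT => u.
  apply: (@continuous_comp _ _ _ row_vec (fun y : V => `|y|)).
    exact: row_vec_continuous.
  exact: norm_continuous.
have [c Sc cmin] := compact_EVT_min S0 cS cf.
have c0 : 0 < `|row_vec c : V|.
  rewrite normr_gt0 raddf_eq0; last exact: row_vec_inj.
  apply/eqP => c0; move: Sc; rewrite inE => c1.
  have : `|c : 'rV[R]_n| = 1 := c1.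
  by rewrite c0 normr0 => /eqP; rewrite eq_sym oner_eq0.
exists (`|row_vec c : V|^-1); first by rewrite invr_ge0.
move=> x; have [->|x0] := eqVneq x 0; first by rewrite raddf0 !normr0 mulr0.
have vx0 : vec_row x != 0 by rewrite raddf_eq0//; exact: vec_row_inj.
have := cmin (`|vec_row x|^-1 *: vec_row x).
rewrite inE => /(_ (normfZV vx0)).
rewrite linearZ/= vec_rowK normrZ normfV normr_id.
by rewrite ler_pdivlMl ?normr_gt0// mulrC ler_pdivlMl.
Qed.

Lemma vec_row_continuous : continuous vec_row.
Proof. by have [C _ /bounded_lin_continuous] := vec_row_bounded. Qed.

Lemma lin_bounded (W : normedModType R) (f : {linear V -> W}) :
  exists2 C, 0 < C & forall x, `|f x| <= C * `|x|.
Proof.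
have [C1 C10 H1] := @row_linear_bounded R W n (f \o row_vec).
have [C2 C20 H2] := vec_row_bounded.
exists (C1 * C2 + 1); first by rewrite ltr_wpDl// mulr_ge0.
move=> x; have := H1 (vec_row x); rewrite /= vec_rowK => h; apply: (le_trans h).
rewrite mulrDl mul1r -mulrA ler_wpDr//.
by rewrite ler_wpM2l// H2.
Qed.

Lemma lin_continuous (W : normedModType R) (f : {linear V -> W}) : continuous f.
Proof. by have [C _ /bounded_lin_continuous] := lin_bounded f. Qed.

Lemma norm_le_coord : exists2 C : R, 0 <= C &
  forall x : V, `|x| <= C * \sum_(j < n) `|coord b j x|.
Proof.
exists (\sum_(j < n) `|b`_j|); first exact: sumr_ge0.
move=> x; rewrite [in leLHS](coord_basis bP (memvf x)).
apply: (le_trans (ler_norm_sum _ _ _)); rewrite mulr_sumr; apply: ler_sum => j _.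
rewrite normrZ mulrC ler_wpM2r// (bigD1 j)//= lerDl; exact: sumr_ge0.
Qed.

Lemma coord_le_norm : exists2 C : R, 0 < C &
  forall x : V, \sum_(j < n) `|coord b j x| <= C * `|x|.
Proof.
pose c i := s2val (cid2 (lin_bounded (coord b i : {linear V -> R^o}))).
have c0 i : 0 < c i by rewrite /c; case: cid2.
exists (\sum_i c i + 1); first by rewrite ltr_wpDl// sumr_ge0// => i _; exact: ltW.
move=> x; apply: (@le_trans _ _ ((\sum_i c i) * `|x|)); last first.
  by rewrite ler_wpM2r// lerDl.
rewrite mulr_suml; apply: ler_sum => j _.
by rewrite /c; case: cid2 => d _ /=; exact.
Qed.

(** Heine-Borel for row vectors, carried over by the coordinate isomorphism, which is bounded in
    both directions. *)
Lemma finite_dim_compact (A : set V) : bounded_set A -> closed A -> compact A.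
Proof.
move=> /bounded_setP[r Ar] cA.
have -> : A = row_vec @` [set u | A (row_vec u)].
  by apply/seteqP; split=> [x Ax|_ [u Au <-]//]; exists (vec_row x); rewrite /= vec_rowK.
apply: continuous_compact; first exact/continuous_subspaceT/row_vec_continuous.
have [C C0 HC] := vec_row_bounded.
apply: bounded_closed_compact.
  apply/bounded_setP; exists (C * r) => u /= Au.
  by have := HC (row_vec u); rewrite row_vecK => /le_trans; apply; rewrite ler_wpM2l// Ar.
by apply: closed_comp => // u _; exact: row_vec_continuous.
Qed.

Lemma finite_dim_Baire (F : (set V)^nat) :
  (forall i, open (F i) /\ dense (F i)) -> dense (\bigcap_i F i).
Proof.
move=> HF O [y Oy] oO.
have : dense (\bigcap_i (row_vec @^-1` F i)).
  apply: Baire => i; have [oF dF] := HF i; split.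
    by apply: open_comp => // u _; exact: row_vec_continuous.
  move=> U [u Uu] oU.
  have oU' : open (vec_row @^-1` U).
    by apply: open_comp => // ? _; exact: vec_row_continuous.
  have [|x [Ux Fx]] := dF _ _ oU'; first by exists (row_vec u); rewrite /= row_vecK.
  by exists (vec_row x); split => //=; rewrite vec_rowK.
move=> /(_ (row_vec @^-1` O))[||u [Ou Fu]].
- by exists (vec_row y); rewrite /= vec_rowK.
- by apply: open_comp => // u _; exact: row_vec_continuous.
- by exists (row_vec u); split => // i _; exact: Fu.
Qed.

End FiniteDim.

(** * Cut and project schemes *)

Section SchemeProjections.
Context (R : realType) (E : normedVectType R) (S : cut_project_scheme E).

Lemma pi_phys_linear : linear (pi_phys S).
Proof. by move=> a u v; rewrite /pi_phys /proj_along !linearP. Qed.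

Lemma pi_intl_linear : linear (pi_intl S).
Proof. by move=> a u v; rewrite /pi_intl /proj_along !linearP. Qed.

HB.instance Definition _ := GRing.isLinear.Build R E _ _ (pi_phys S) pi_phys_linear.
HB.instance Definition _ := GRing.isLinear.Build R E _ _ (pi_intl S) pi_intl_linear.

End SchemeProjections.

Section SchemeGeometry.
Context (R : realType) (E : normedVectType R) (S : cut_project_scheme E).

Notation V := (subvs_of (phys S)).
Notation N := (subvs_of (intl S)).
Notation pV := (pi_phys S).
Notation pN := (pi_intl S).
Notation G := (lat S).

Lemma cap_intl_phys : (intl S :&: phys S = 0)%VS.
Proof. by rewrite capvC cps_cap. Qed.

Lemma val_pi_phys x : vsval (pV x) = daddv_pi (phys S) (intl S) x.
Proof. by rewrite vsprojK// memv_pi. Qed.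

Lemma val_pi_intl x : vsval (pN x) = daddv_pi (intl S) (phys S) x.
Proof. by rewrite vsprojK// memv_pi. Qed.

Lemma pi_decomp x : vsval (pV x) + vsval (pN x) = x.
Proof. by rewrite val_pi_phys val_pi_intl daddv_pi_add ?cps_cap// cps_add memvf. Qed.

Lemma pi_phys_val (v : V) : pV (vsval v) = v.
Proof. by apply: val_inj; rewrite /= val_pi_phys daddv_pi_id ?cps_cap// subvsP. Qed.

Lemma pi_intl_val (n : N) : pN (vsval n) = n.
Proof. by apply: val_inj; rewrite /= val_pi_intl daddv_pi_id ?cap_intl_phys// subvsP. Qed.

Lemma pi_intl_phys (v : V) : pN (vsval v) = 0.
Proof.
apply: val_inj; have := pi_decomp (vsval v).
by rewrite pi_phys_val -[RHS]addr0 => /addrI.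
Qed.

Lemma pi_phys_intl (n : N) : pV (vsval n) = 0.
Proof.
apply: val_inj; have := pi_decomp (vsval n).
by rewrite pi_intl_val -[RHS]add0r => /addIr.
Qed.

Lemma norm_le_pi x : `|x| <= `|pV x| + `|pN x|.
Proof. by rewrite -[in leLHS](pi_decomp x) ler_normD. Qed.

Lemma lat_coordP : exists2 b : (\dim {:E}).-tuple E, basis_of {:E} b &
  forall x, G x <-> exists a : {ffun 'I_(\dim {:E}) -> int}, x = \sum_(i < \dim {:E}) b`_i *~ a i.
Proof. by case: (lat_full S) => b bb ->; exists b. Qed.

Lemma lat0 : G 0.
Proof.
have [b _ ->] := lat_coordP; exists [ffun=> 0].
by rewrite big1// => i _; rewrite ffunE.
Qed.

Lemma latB x y : G x -> G y -> G (x - y).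
Proof.
have [b _ HG] := lat_coordP => /HG[a ->] /HG[a' ->]; apply/HG.
exists [ffun i => a i - a' i]; rewrite -sumrB; apply: eq_bigr => i _.
by rewrite ffunE mulrzBr.
Qed.

Lemma latN x : G x -> G (- x).
Proof. by rewrite -sub0r; apply: latB; exact: lat0. Qed.

Lemma latD x y : G x -> G y -> G (x + y).
Proof. by move=> Gx /latN Gy; rewrite -(opprK y); exact: latB. Qed.

Lemma lat_pi_phys_inj x y : G x -> G y -> pV x = pV y -> x = y.
Proof. by move=> Gx Gy; apply: (@phys_inj _ _ S); rewrite inE. Qed.

Lemma lat_dense (O : set N) : open O -> O !=set0 -> exists2 g, G g & O (pN g).
Proof.
by move=> oO O0; have [x [Ox [g Gg gx]]] := intl_dense O0 oO; exists g; rewrite // /pi_intl gx.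
Qed.

Lemma lat_near (n : N) (e : R) : 0 < e -> exists2 g, G g & `|pN g - n| < e.
Proof.
move=> e0; have [||g Gg] := @lat_dense (ball n e); first exact: ball_open.
  by exists n; exact: ballxx.
by rewrite -ball_normE /= distrC; exists g.
Qed.

(** Bounded projections bound the integer coordinates in a lattice basis. The finite index type
    stores a coordinate in [[-K, K]] as a natural number shifted by [K]. *)
Lemma lat_locally_finite (r r' : R) :
  finite_set [set x | [/\ G x, `|pV x| <= r & `|pN x| <= r']].
Proof.
have [b bb HG] := lat_coordP; pose n := \dim {:E}.
have [C C0 HC] : exists2 C : R, 0 < C & forall i x, `|coord b i x| <= C * `|x|.
  pose CC i := s2val (cid2 (lin_bounded (coord b i : {linear E -> R^o}))).
  exists (\sum_i CC i + 1) => [|i x].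
    by rewrite ltr_wpDl// sumr_ge0// => i _; rewrite /CC; case: cid2 => c /= /ltW.
  have : `|coord b i x| <= CC i * `|x| by rewrite /CC; case: cid2 => c /= _; exact.
  move/le_trans; apply; rewrite ler_wpM2r// ler_wpDr// (bigD1 i)//= ler_wpDr//.
  by rewrite sumr_ge0// => j _; rewrite /CC; case: cid2 => c /= /ltW.
pose K := Num.truncn (C * (r + r')).
pose f (k : {ffun 'I_n -> 'I_(K + K).+1}) : E := \sum_(i < n) b`_i *~ ((k i)%:Z - K%:Z).
apply: (@sub_finite_set _ _ (f @` setT)); last exact/finite_image/finite_finset.
move=> x [/HG[a xa] xr xr'].
have ha i : (`|a i|%N <= K)%N.
  have : `|coord b i x| <= C * (r + r').
    apply: (le_trans (HC i x)); rewrite ler_pM2l//.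
    by apply: (le_trans (norm_le_pi x)); rewrite lerD.
  have -> : coord b i x = (a i)%:~R.
    rewrite xa; under eq_bigr do rewrite -scaler_int.
    by rewrite coord_sum_free// (basis_free bb).
  rewrite -intr_norm -abszE -pmulrn => h.
  by rewrite -ltnS -(@ltr_nat R); exact: (le_lt_trans h (truncnS_gt _)).
exists [ffun i => inord (absz (a i + K%:Z))] => //.
rewrite /f xa; apply: eq_bigr => i _; rewrite ffunE inordK; last first.
  by have := ha i; lia.
by congr (_ *~ _); have := ha i; lia.
Qed.

End SchemeGeometry.

(** * Interiors, closures and boundaries under homeomorphisms and translations *)

Section Homeomorphisms.
Context (T T' : topologicalType) (f : T -> T') (g : T' -> T).
Hypotheses (fg : cancel f g) (gf : cancel g f).
Hypotheses (cf : continuous f) (cg : continuous g).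

Lemma homeo_image (A : set T) : f @` A = g @^-1` A.
Proof.
by apply/seteqP; split=> [_ [x Ax <-]|y Ay]; [rewrite /= fg|exists (g y)].
Qed.

Lemma homeo_preimage_interior (A : set T) : g @^-1` A° = (g @^-1` A)°.
Proof.
apply/seteqP; split=> [y /cg //|y].
rewrite /preimage /interior /= => h.
have : nbhs (f (g y)) [set t | A (g t)] by rewrite gf.
move=> /cf h'; have {h'} : nbhs (g y) [set x | A (g (f x))] by [].
by apply: filterS => x /=; rewrite fg.
Qed.

Lemma homeo_interior (A : set T) : (f @` A)° = f @` A°.
Proof. by rewrite !homeo_image homeo_preimage_interior. Qed.

Lemma homeo_closure (A : set T) : closure (f @` A) = f @` closure A.
Proof.
apply: setC_inj; rewrite -interiorC !homeo_image.
by rewrite 2!preimage_setC -homeo_preimage_interior interiorC.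
Qed.

End Homeomorphisms.

Section Translates.
Context (R : realType) (V : normedVectType R).
Implicit Types (A : set V) (t x : V).

Lemma translateE t A x : translate t A x <-> A (x - t).
Proof.
by split=> [[y Ay <-]|Axt]; [rewrite addrK|exists (x - t); rewrite // subrK].
Qed.

Lemma continuous_translation t : continuous (fun x : V => x + t).
Proof. by move=> x; apply: cvgD; [exact: cvg_id|exact: cvg_cst]. Qed.

Lemma continuous_reflection t : continuous (fun x : V => t - x).
Proof. by move=> x; apply: cvgB; [exact: cvg_cst|exact: cvg_id]. Qed.

Let addK t : cancel (fun x => x + t) (fun x => x - t). Proof. by move=> x; rewrite addrK. Qed.
Let subK t : cancel (fun x => x - t) (fun x => x + t). Proof. by move=> x; rewrite subrK. Qed.

Lemma translate_interior t A : (translate t A)° = translate t A°.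
Proof.
exact: (homeo_interior (addK t) (subK t) (@continuous_translation t)
  (@continuous_translation (- t))).
Qed.

Lemma translate_closure t A : closure (translate t A) = translate t (closure A).
Proof.
exact: (homeo_closure (addK t) (subK t) (@continuous_translation t)
  (@continuous_translation (- t))).
Qed.

Lemma translate_regclosed t A : regclosed A -> regclosed (translate t A).
Proof.
by rewrite /regclosed => rA; rewrite translate_interior translate_closure rA.
Qed.

Lemma translate_boundary t A x : boundary (translate t A) x <-> boundary A (x - t).
Proof.
rewrite /boundary translate_interior translate_closure /setD /=.
by rewrite !translateE.
Qed.

Lemma regclosed_closed A : regclosed A -> closed A.
Proof. by move=> <-; exact: closed_closure. Qed.

Lemma regclosed_interior_neq0 A : regclosed A -> A !=set0 -> A° !=set0.
Proof.
move=> rA; apply: contraPP => /set0P/negP/negPn/eqP A0.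
by rewrite -rA A0 closure0 => -[].
Qed.

Lemma regclosed_boundary A x : regclosed A -> boundary A x <-> A x /\ ~ A° x.
Proof. by rewrite /boundary => /regclosed_closed/closure_id <-. Qed.

Lemma translate_bounded t A : bounded_set A -> bounded_set (translate t A).
Proof.
move=> /bounded_setP[r Ar]; apply/bounded_setP; exists (r + `|t|).
by move=> _ [y Ay <-]; rewrite (le_trans (ler_normD _ _))// lerD2r Ar.
Qed.

End Translates.

(** * Density of the lattice and existence of non-singular parameters *)

Section SchemeDensity.
Context (R : realType) (E : normedVectType R) (S : cut_project_scheme E).

Notation V := (subvs_of (phys S)).
Notation N := (subvs_of (intl S)).
Notation pV := (pi_phys S).
Notation pN := (pi_intl S).
Notation G := (lat S).

Lemma lat_bounded_mod : exists B : R, forall x : E, exists2 g, G g & `|x - g| <= B.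
Proof.
have [b bb HG] := lat_coordP S.
exists (\sum_(i < \dim {:E}) `|b`_i|) => x.
exists (\sum_(i < \dim {:E}) b`_i *~ Num.floor (coord b i x)).
  by apply/HG; exists [ffun i => Num.floor (coord b i x)]; apply: eq_bigr => i _; rewrite ffunE.
rewrite {1}(coord_basis bb (memvf x)) -sumrB.
apply: (le_trans (ler_norm_sum _ _ _)); apply: ler_sum => i _.
rewrite -scaler_int -scalerBl normrZ ler_piMl// ger0_norm ?subr_ge0 ?floor_le//.
by rewrite lerBlDl -intrD1 ltW// floorD1_gt.
Qed.

(* Every element of the lattice can be reached in the internal space by short
   steps, by density. *)
Lemma lat_generated (e : R) (H : E -> Prop) : 0 < e ->
  (forall x y, H x -> H y -> H (x + y)) ->
  (forall g, G g -> `|pN g| < e -> H g) -> forall g, G g -> H g.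
Proof.
move=> e0 HD Hsmall; have e20 : 0 < e / 2 by rewrite divr_gt0.
(* The induction counts how many steps of length [e / 2] reach the internal part of [g]. *)
suff main m g : G g -> `|pN g| < m%:R * (e / 2) -> H g.
  move=> g Gg; apply: (main (Num.truncn (`|pN g| / (e / 2))).+1) => //.
  by rewrite -ltr_pdivrMr// truncnS_gt.
elim: m g => [|m IH] g Gg; first by rewrite mul0r ltNge normr_ge0.
case: m IH => [|m] IH hg.
  by apply: Hsmall => //; apply: (lt_le_trans hg); rewrite mul1r; lra.
(* The point [t *: pN g] has norm below [m.+1%:R * (e / 2)] and lies within [e] of [pN g]. By
   density so does some [pN h]: the induction applies to [h], and [g - h] is short. *)
pose t : R := m.+1%:R / m.+2%:R.
have t0 : 0 < t by rewrite divr_gt0// ltr0n.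
have [||h Gh [/= h1 h2]] :=
  @lat_dense _ _ S (ball (0 : N) (m.+1%:R * (e / 2)) `&` ball (pN g) e).
- by apply: openI; exact: ball_open.
- exists (t *: pN g); split; rewrite -ball_normE /=.
    rewrite sub0r normrN normrZ gtr0_norm// /t.
    by rewrite -mulrA ltr_pM2l ?ltr0n// ltr_pdivrMl ?ltr0n// mulrC mulrA.
  rewrite -{1}[pN g]scale1r -scalerBl normrZ.
  have -> : 1 - t = m.+2%:R^-1.
    by rewrite /t -[X in X - _](@divff _ m.+2%:R) ?pnatr_eq0// -mulrBl -natrB// subSnn mul1r.
  rewrite ger0_norm ?invr_ge0// ltr_pdivrMl ?ltr0n//.
  by apply: (lt_le_trans hg); rewrite ler_pM2l ?ltr0n//; lra.
move: h1 h2; rewrite -!ball_normE /= sub0r normrN => h1 h2.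
rewrite -(subrK h g); apply: HD; last exact: IH.
by apply: Hsmall; [exact: latB|rewrite linearB].
Qed.

(** Modulo the lattice, [v] and [t] reduce to a bounded vector [k] whose internal part lies in a
    compact ball. Finitely many of the sets [[set n | O (pN g - n)]] cover that ball, which makes
    [r] independent of [v] and [t]. *)
Lemma lat_cover (O : set N) : open O -> O !=set0 ->
  exists r : R, forall (v : V) (t : N),
    exists2 g, G g & `|pV g - v| <= r /\ O (pN g - t).
Proof.
move=> oO O0; have [B HB] := lat_bounded_mod.
have [CV CV0 HV] := lin_bounded (pV : {linear E -> V}).
have [CN CN0 HN] := lin_bounded (pN : {linear E -> N}).
pose K : set N := [set n | `|n| <= CN * B].
have cK : compact K.
  apply: finite_dim_compact; first by apply/bounded_setP; exists (CN * B).
  have -> : K = (fun n : N => `|n|) @^-1` [set y | y <= CN * B] by [].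
  by apply: closed_comp => [n _|]; [exact: norm_continuous|exact: closed_le].
have : cover_compact K by rewrite -compact_cover.
move=> /(_ _ G (fun g => [set n | O (pN g - n)]))[||D DG DK].
- move=> g Gg; apply: (open_comp (f := fun n : N => pN g - n)) => // n _.
  exact: continuous_reflection.
- move=> n _; have [||g Gg Og] := @lat_dense _ _ S (translate n O).
  + by apply/interior_id; rewrite translate_interior; congr translate; apply/interior_id.
  + by case: O0 => o Oo; exists (o + n); exists o.
  + by exists g => //=; apply/translateE.
exists (CV * B + \sum_(g <- finmap.enum_fset D) `|pV g|) => v t.
have [g0 Gg0 hg0] := HB (vsval v + vsval t).
set k := vsval v + vsval t - g0 in hg0.
have pVk : pV g0 = v - pV k.
  have -> : pV k = v - pV g0; last by rewrite subKr.
  by rewrite linearB/= linearD/= pi_phys_val pi_phys_intl addr0.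
have pNk : pN g0 = t - pN k.
  have -> : pN k = t - pN g0; last by rewrite subKr.
  by rewrite linearB/= linearD/= pi_intl_val pi_intl_phys add0r.
have Kk : K (pN k) by apply: (le_trans (HN k)); rewrite ler_pM2l.
have [g /= gD Og] := DK _ Kk.
exists (g + g0); first by apply: latD => //; move: (DG _ gD); rewrite inE.
split; last by rewrite linearD/= pNk addrA addrAC addrK.
rewrite linearD/= pVk addrA addrAC addrK addrC.
apply: (le_trans (ler_normD _ _)); rewrite normrN lerD//.
  by apply: (le_trans (HV k)); rewrite ler_pM2l.
rewrite (big_rem g)//= lerDl sumr_ge0//.
Qed.

(** Each lattice point and colour excludes a closed nowhere dense set of parameters. There are
    countably many such pairs, so Baire category leaves a parameter. *)
Lemma nonsingular_exists l (W : 'I_l -> set N) :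
  (forall i, regclosed (W i)) -> exists s, nonsingular (shift_window s W).
Proof.
move=> rW; have [b bb HG] := lat_coordP S.
pose T := ({ffun 'I_(\dim {:E}) -> int} * 'I_l)%type.
pose gam (a : {ffun 'I_(\dim {:E}) -> int}) : E := \sum_(i < \dim {:E}) b`_i *~ a i.
pose O (t : T) : set N := [set s | ~ boundary (W t.2) (pN (gam t.1) - s)].
pose F (n : nat) := if unpickle n is Some t then O t else setT.
have odO t : open (O t) /\ dense (O t).
  have cl i : closed (boundary (W i)).
    have -> : boundary (W i) = closure (W i) `&` ~` (W i)° by [].
    by apply: closedI; [exact: closed_closure|apply: open_closedC; exact: open_interior].
  split.
    apply: (open_comp (f := fun s : N => pN (gam t.1) - s) (D := ~` boundary (W t.2))).
      by move=> n _; exact: continuous_reflection.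
    exact: closed_openC.
  (* An open set of excluded parameters would reflect to a neighbourhood, inside the window, of a
     boundary point. *)
  move=> U [u Uu] oU; apply: contrapT => /set0P/negP/negPn/eqP UO.
  have Ub s : U s -> boundary (W t.2) (pN (gam t.1) - s).
    move=> Us; apply: contrapT => nb.
    by have : (U `&` O t) s by []; rewrite UO.
  have [_ []] := Ub u Uu.
  rewrite /interior; have : nbhs u U by exact: open_nbhs_nbhs.
  pose f (s : N) : N := pN (gam t.1) - s.
  have cf : continuous f by exact: continuous_reflection.
  have ff : involutive f by move=> x; rewrite /f opprB addrC subrK.
  rewrite -{1}(ff u) => /cf h; have {h} : nbhs (f u) [set s | U (f s)] by [].
  apply: filterS => x /= /Ub; rewrite -/(f _) ff.
  by rewrite regclosed_boundary// => -[].
have [|||s [_ Fs]] := @finite_dim_Baire _ _ F _ setT.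
- move=> n; rewrite /F; case: unpickle => [t|]; first exact: odO.
  by split; [exact: openT|move=> U U0 _; rewrite setIT].
- by exists 0.
- exact: openT.
exists s => i; apply/seteqP; split=> // x [[g /HG[a ga] <-] /translate_boundary bx].
have := Fs (pickle (a, i)) I; rewrite /F pickleK /O /=; apply.
by rewrite /gam -ga.
Qed.

End SchemeDensity.

(** * Window algebras and local determination *)

Section LocalDetermination.
Context (R : realType) (E : normedVectType R) (S : cut_project_scheme E).

Notation V := (subvs_of (phys S)).
Notation N := (subvs_of (intl S)).
Notation pV := (pi_phys S).
Notation pN := (pi_intl S).
Notation G := (lat S).

(* Up to local rules a pattern contained in the physical projection of the lattice
   is a family X of predicates on the lattice, X i x meaning that pV x has colour
   i; [agree c X x y] compares the patches of radius c at pV x and pV y. *)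
Definition in_window l (W : 'I_l -> set N) (s : N) (i : 'I_l) (x : E) : Prop :=
  W i (pN x - s).

Definition agree (c : R) l (X : 'I_l -> E -> Prop) (x y : E) : Prop :=
  forall h, G h -> `|pV h| <= c -> forall i, X i (x + h) <-> X i (y + h).

Definition determines (c : R) l (X : 'I_l -> E -> Prop) (D : E -> Prop) : Prop :=
  forall x y, G x -> G y -> agree c X x y -> (D x <-> D y).

Lemma agree_le c c' l (X : 'I_l -> E -> Prop) x y :
  c <= c' -> agree c' X x y -> agree c X x y.
Proof. by move=> cc' a h Gh hc; apply: a => //; exact: le_trans cc'. Qed.

Lemma determines_le c c' l (X : 'I_l -> E -> Prop) D :
  c <= c' -> determines c X D -> determines c' X D.
Proof. by move=> cc' d x y Gx Gy a; apply: d => //; exact: agree_le a. Qed.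

Lemma agree_shift c l (X : 'I_l -> E -> Prop) x y g : G g ->
  agree (c + `|pV g|) X x y -> agree c X (x + g) (y + g).
Proof.
move=> Gg a h Gh hc i; rewrite -!addrA; apply: a; first exact: latD.
by rewrite linearD/= addrC (le_trans (ler_normD _ _))// lerD2r.
Qed.

Lemma determines_shift c l (X : 'I_l -> E -> Prop) D g : G g ->
  determines c X D -> determines (c + `|pV g|) X (fun x => D (x - g)).
Proof.
move=> Gg d x y Gx Gy a; apply: d; [exact: latB|exact: latB|].
by apply: agree_shift; [exact: latN|rewrite linearN normrN].
Qed.

Lemma in_window_shift l (W : 'I_l -> set N) (s t : N) i x :
  in_window (shift_window s W) t i x <-> in_window W (t + s) i x.
Proof. by rewrite /in_window /shift_window translateE opprD addrA. Qed.

Lemma nonsingularP l (W : 'I_l -> set N) (s : N) :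
  nonsingular (shift_window s W) <-> forall g i, G g -> ~ boundary (W i) (pN g - s).
Proof.
split=> [ns g i Gg bg|ns i].
  have : (@lat_intl _ _ S `&` boundary (shift_window s W i)) (pN g).
    by split; [exists g|exact/translate_boundary].
  by rewrite ns.
by apply/seteqP; split=> // x [[g Gg <-]] /translate_boundary; exact: ns.
Qed.

(** * Regularised Boolean operations off the boundaries *)

Section RegularOperations.
Implicit Types (U : set N) (p : N).

Lemma interior_not_boundary U p : ~ boundary U p -> U p -> U° p.
Proof.
by move=> nb Up; apply: contrapT => nU; apply: nb; split=> //; exact: subset_closure.
Qed.

(** When [O] and its closure both agree with [P] at [p], closing [O] creates no boundary there. The
    three regularised operations are instances of this. *)
Lemma closure_open_trace (O : set N) (P : Prop) p : open O ->
  (closure O p -> P) -> (P -> O p) ->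
  (closure O p <-> P) /\ ~ boundary (closure O) p.
Proof.
move=> oO h1 h2; split; first by split=> // /h2; exact: subset_closure.
move=> [+ nint]; rewrite -(closure_id _).1; last exact: closed_closure.
move=> /h1/h2 Op; apply: nint; apply: (interiorS (@subset_closure _ O)).
by rewrite ((interior_id O).1 oO).
Qed.

Lemma reg_meetP U U' p : regclosed U -> regclosed U' ->
  ~ boundary U p -> ~ boundary U' p ->
  (reg_meet U U' p <-> U p /\ U' p) /\ ~ boundary (reg_meet U U') p.
Proof.
move=> rU rU' bU bU'; apply: closure_open_trace; first exact: open_interior.
  have cUU' : closed (U `&` U') by apply: closedI; exact: regclosed_closed.
  by move=> /(closureS (@interior_subset _ _)); rewrite -(closure_id _).1.
by move=> [Up U'p]; rewrite interiorI; split; exact: interior_not_boundary.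
Qed.

Lemma reg_joinP U U' p : regclosed U -> regclosed U' ->
  ~ boundary U p -> ~ boundary U' p ->
  (reg_join U U' p <-> U p \/ U' p) /\ ~ boundary (reg_join U U') p.
Proof.
move=> rU rU' bU bU'; apply: closure_open_trace; first exact: open_interior.
  have cUU' : closed (U `|` U') by apply: closedU; exact: regclosed_closed.
  by move=> /(closureS (@interior_subset _ _)); rewrite -(closure_id _).1.
by move=> UU'; apply: interiorU; case: UU' => h; [left|right]; exact: interior_not_boundary.
Qed.

Lemma reg_complP U p : regclosed U -> ~ boundary U p ->
  (reg_compl U p <-> ~ U p) /\ ~ boundary (reg_compl U) p.
Proof.
move=> rU bU; have oU : open (~` U) by apply: closed_openC; exact: regclosed_closed.
apply: closure_open_trace; first exact: open_interior.
  move=> /(closureS (@interior_subset _ _)); rewrite closure_setC => nUp Up.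
  by apply: nUp; exact: interior_not_boundary.
by rewrite ((interior_id _).1 oU).
Qed.

Lemma regclosed_set0 : regclosed (set0 : set N).
Proof. by rewrite /regclosed interior0 closure0. Qed.

Lemma regclosed_setT : regclosed (setT : set N).
Proof. by rewrite /regclosed interiorT closureT. Qed.

Lemma boundary_set0 p : ~ boundary (set0 : set N) p.
Proof. by rewrite /boundary closure0 => -[]. Qed.

Lemma boundary_setT p : ~ boundary (setT : set N) p.
Proof. by rewrite /boundary interiorT => -[_]; apply. Qed.

Lemma regclosed_reg (O : set N) : regclosed (closure O°).
Proof. by apply: closure_open_regclosed; exact: open_interior. Qed.

(** A regular closed set is the closure of its interior and the projected lattice is dense, so
    lattice points alone decide inclusion in a closed set. *)
Lemma regclosed_subset (U U' : set N) (s : N) : regclosed U -> closed U' ->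
  (forall g, G g -> U° (pN g - s) -> U' (pN g - s)) -> U `<=` U'.
Proof.
move=> rU cU' h; rewrite -rU ((closure_id U').1 cU'); apply: closureS => p Up.
apply: contrapT => U'p.
have [||g Gg] := @lat_dense _ _ S (translate s (U° `&` ~` U')).
- apply/interior_id; rewrite translate_interior; congr translate.
  by apply/interior_id; apply: openI; [exact: open_interior|exact: closed_openC].
- by exists (p + s), p.
by move=> /translateE[/(h g Gg)].
Qed.

End RegularOperations.

(** * Local rules for members of the window algebra *)

Section WindowAlgebra.
Context (l : nat) (W : 'I_l -> set N).
Hypothesis rW : forall i, regclosed (W i).

Lemma window_algebra_ind (F : set (set N)) :
  boolean_subalgebra F ->
  (forall i g, G g -> F (translate (pN g) (W i))) -> window_algebra W `<=` F.
Proof.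
move=> bF HF; apply: smallest_sub => // U [i [_ [g Gg <-] ->]]; exact: HF.
Qed.

Lemma window_algebra_gen i g : G g -> window_algebra W (translate (pN g) (W i)).
Proof.
by move=> Gg; apply: sub_gen_smallest; exists i; exists (pN g) => //; exists g.
Qed.

Lemma boolean_regclosed : boolean_subalgebra [set U : set N | regclosed U].
Proof.
split=> //; first by split; [exact: regclosed_set0|exact: regclosed_setT].
- by move=> U U' _ _; exact: regclosed_reg.
- by move=> U U' _ _; exact: regclosed_reg.
- by move=> U _; exact: regclosed_reg.
Qed.

Lemma window_algebra_boolean : boolean_subalgebra (window_algebra W).
Proof.
split.
- apply: window_algebra_ind; first exact: boolean_regclosed.
  by move=> i g _; exact: translate_regclosed.
- by split=> F [[_ [F0 FT] _ _ _] _].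
- by move=> U U' hU hU' F hF; case: (hF) => -[_ _ H _ _] _; apply: H; [exact: hU|exact: hU'].
- by move=> U U' hU hU' F hF; case: (hF) => -[_ _ _ H _] _; apply: H; [exact: hU|exact: hU'].
- by move=> U hU F hF; case: (hF) => -[_ _ _ _ H] _; apply: H; exact: hU.
Qed.

Lemma window_algebra_regclosed U : window_algebra W U -> regclosed U.
Proof. by case: window_algebra_boolean => H _ _ _ _ /H. Qed.

(* The radius works for all non-singular translates at once: it only depends on
   the Boolean combination that expresses U. *)
Lemma window_algebra_determines U : window_algebra W U ->
  exists c, forall s, nonsingular (shift_window s W) ->
    (forall g, G g -> ~ boundary U (pN g - s)) /\
    determines c (in_window W s) (fun x => U (pN x - s)).
Proof.
(* Regularity is carried along, because the pointwise description of the operations is available for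
   regular closed sets. *)
pose F : set (set N) := [set U | regclosed U /\
  exists c, forall s, nonsingular (shift_window s W) ->
    (forall g, G g -> ~ boundary U (pN g - s)) /\
    determines c (in_window W s) (fun x => U (pN x - s))].
suff sub : window_algebra W `<=` F by move=> /sub[].
apply: window_algebra_ind => [|i g Gg]; first split.
- by move=> U' [].
- split; split; [exact: regclosed_set0| |exact: regclosed_setT|]; exists 0 => s _; split => //.
    by move=> g _; exact: boundary_set0.
  by move=> g _; exact: boundary_setT.
- move=> U1 U2 [r1 [c1 h1]] [r2 [c2 h2]]; split; first exact: regclosed_reg.
  exists (Num.max c1 c2) => s ns; have [b1 d1] := h1 s ns; have [b2 d2] := h2 s ns.
  have c1c : c1 <= Num.max c1 c2 by rewrite le_max lexx.
  have c2c : c2 <= Num.max c1 c2 by rewrite le_max lexx orbT.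
  split=> [g Gg|x y Gx Gy a]; first by case: (reg_meetP r1 r2 (b1 g Gg) (b2 g Gg)).
  have [-> _] := reg_meetP r1 r2 (b1 x Gx) (b2 x Gx).
  have [-> _] := reg_meetP r1 r2 (b1 y Gy) (b2 y Gy).
  by rewrite (d1 x y Gx Gy (agree_le c1c a)) (d2 x y Gx Gy (agree_le c2c a)).
- move=> U1 U2 [r1 [c1 h1]] [r2 [c2 h2]]; split; first exact: regclosed_reg.
  exists (Num.max c1 c2) => s ns; have [b1 d1] := h1 s ns; have [b2 d2] := h2 s ns.
  have c1c : c1 <= Num.max c1 c2 by rewrite le_max lexx.
  have c2c : c2 <= Num.max c1 c2 by rewrite le_max lexx orbT.
  split=> [g Gg|x y Gx Gy a]; first by case: (reg_joinP r1 r2 (b1 g Gg) (b2 g Gg)).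
  have [-> _] := reg_joinP r1 r2 (b1 x Gx) (b2 x Gx).
  have [-> _] := reg_joinP r1 r2 (b1 y Gy) (b2 y Gy).
  by rewrite (d1 x y Gx Gy (agree_le c1c a)) (d2 x y Gx Gy (agree_le c2c a)).
- move=> U1 [r1 [c1 h1]]; split; first exact: regclosed_reg.
  exists c1 => s ns; have [b1 d1] := h1 s ns.
  split=> [g Gg|x y Gx Gy a]; first by case: (reg_complP r1 (b1 g Gg)).
  have [-> _] := reg_complP r1 (b1 x Gx).
  have [-> _] := reg_complP r1 (b1 y Gy).
  by rewrite (d1 x y Gx Gy a).
- split; first exact: translate_regclosed.
  exists (`|pV g|) => s /nonsingularP ns; split=> [h Gh /translate_boundary|x y Gx Gy a].
    by rewrite addrAC -linearB; apply: ns; exact: latB.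
  rewrite !translateE -!(addrAC _ (- pN g)) -!linearB.
  by apply: a; [exact: latN|rewrite linearN normrN].
Qed.

End WindowAlgebra.

(** Each [W' j] is a generator, the translate by 0, and the largest radius over the colours serves
    them all. The radius is chosen before [s], so it stays valid along a whole orbit of
    parameters. *)
Lemma constructable_determines l m (W' : 'I_m -> set N) (W : 'I_l -> set N) :
  (forall i, regclosed (W i)) -> constructable_from W' W ->
  exists c, forall s, nonsingular (shift_window s W) ->
    nonsingular (shift_window s W') /\
    forall j, determines c (in_window W s) (in_window W' s j).
Proof.
move=> rW cW.
have h j : exists c, forall s, nonsingular (shift_window s W) ->
    (forall g, G g -> ~ boundary (W' j) (pN g - s)) /\
    determines c (in_window W s) (in_window W' s j).
  apply: window_algebra_determines => //; apply: cW.
  have := @window_algebra_gen _ W' j 0 (lat0 S); rewrite linear0.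
  suff -> : translate 0 (W' j) = W' j by [].
  by apply/seteqP; split=> x; rewrite translateE subr0.
pose c j := sval (cid (h j)).
have cP j := svalP (cid (h j)).
exists (\big[Num.max/0]_j c j) => s ns; split.
  by apply/nonsingularP => g j Gg; have [H _] := cP j s ns; exact: H.
move=> j; have [_] := cP j s ns; apply: determines_le.
exact: (le_bigmax _ (fun j => c j) j).
Qed.
End LocalDetermination.

(** * From local rules back to members of the window algebra *)

Section Definability.
Context (R : realType) (E : normedVectType R) (S : cut_project_scheme E).

Notation V := (subvs_of (phys S)).
Notation N := (subvs_of (intl S)).
Notation pV := (pi_phys S).
Notation pN := (pi_intl S).
Notation G := (lat S).
Notation agree := (@agree R E S).
Notation determines := (@determines R E S).

Context (l : nat) (W : 'I_l -> set N) (s : N).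
Hypotheses (rW : forall i, regclosed (W i)) (ns : nonsingular (shift_window s W)).

(** These are the traces on the lattice, at parameter [s], of members of the window algebra.
    Non-singularity lets the algebra operations act pointwise on them. *)
Definition definable (D : E -> Prop) : Prop :=
  exists2 U, window_algebra W U & forall g, G g -> (U (pN g - s) <-> D g).

Let not_boundary U g : window_algebra W U -> G g -> ~ boundary U (pN g - s).
Proof.
by move=> /(window_algebra_determines rW)[c /(_ s ns)[b _]] Gg; exact: b.
Qed.

Lemma definable_ext D D' :
  (forall g, G g -> D g <-> D' g) -> definable D -> definable D'.
Proof. by move=> DD' [U hU UD]; exists U => // g Gg; rewrite UD// DD'. Qed.

Lemma definable_const (P : Prop) : definable (fun=> P).
Proof.
have [_ [a0 aT] _ _ _] := window_algebra_boolean rW.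
by have [p|np] := pselect P; [exists setT|exists set0] => // g _; split.
Qed.

Lemma definable_and D D' :
  definable D -> definable D' -> definable (fun x => D x /\ D' x).
Proof.
have [_ _ aI _ _] := window_algebra_boolean rW.
move=> [U hU UD] [U' hU' UD']; exists (reg_meet U U') => [|g Gg]; first exact: aI.
have [-> _] := reg_meetP (window_algebra_regclosed rW hU) (window_algebra_regclosed rW hU')
  (not_boundary hU Gg) (not_boundary hU' Gg).
by rewrite UD// UD'.
Qed.

Lemma definable_or D D' :
  definable D -> definable D' -> definable (fun x => D x \/ D' x).
Proof.
have [_ _ _ aU _] := window_algebra_boolean rW.
move=> [U hU UD] [U' hU' UD']; exists (reg_join U U') => [|g Gg]; first exact: aU.
have [-> _] := reg_joinP (window_algebra_regclosed rW hU) (window_algebra_regclosed rW hU')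
  (not_boundary hU Gg) (not_boundary hU' Gg).
by rewrite UD// UD'.
Qed.

Lemma definable_not D : definable D -> definable (fun x => ~ D x).
Proof.
have [_ _ _ _ aC] := window_algebra_boolean rW.
move=> [U hU UD]; exists (reg_compl U) => [|g Gg]; first exact: aC.
have [-> _] := reg_complP (window_algebra_regclosed rW hU) (not_boundary hU Gg).
by rewrite UD.
Qed.

Lemma definable_in_window i h : G h -> definable (fun x => in_window W s i (x + h)).
Proof.
move=> Gh; exists (translate (pN (- h)) (W i)).
  by apply: window_algebra_gen; exact: latN.
by move=> g Gg; rewrite translateE -addrAC linearN opprK -linearD.
Qed.

(** A predicate that depends on finitely many definable tests is a Boolean combination of them; the
    induction splits off one test according to its truth value. *)
Lemma definable_finite (T : eqType) (ts : seq T) (P : T -> E -> Prop) D :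
  (forall t, t \in ts -> definable (P t)) ->
  (forall x y, G x -> G y -> (forall t, t \in ts -> (P t x <-> P t y)) -> D x -> D y) ->
  definable D.
Proof.
elim: ts D => [|t ts IH] D dP HD.
  have [[x Gx Dx]|nD] := pselect (exists2 x, G x & D x).
    apply: definable_ext (definable_const True) => g Gg; split=> // _.
    exact: (HD x g Gx Gg _ Dx).
  by apply: definable_ext (definable_const False) => g Gg; split=> // Dg; apply: nD; exists g.
have dts t' : t' \in ts -> definable (P t') by move=> h; apply: dP; rewrite inE h orbT.
have dt : definable (P t) by apply: dP; rewrite inE eqxx.
(* Some point of [D] gives test [t] the value [Q] and agrees with [x] on the remaining tests. *)
pose DQ (Q : Prop) x := exists y, [/\ G y, D y, P t y <-> Q &
  forall t', t' \in ts -> (P t' x <-> P t' y)].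
have dDQ Q : definable (DQ Q).
  apply: IH => // x y Gx Gy xy [z [Gz Dz zQ xz]]; exists z; split=> // t' ht'.
  by rewrite -xy// xz.
apply: definable_ext (definable_or (definable_and dt (dDQ True))
  (definable_and (definable_not dt) (dDQ False))) => g Gg; split=> [|Dg]; last first.
  by have [tg|tg] := pselect (P t g); [left|right]; split=> //; exists g.
move=> h.
have [y [Gy Dy ty hy]] : exists y, [/\ G y, D y, P t y <-> P t g &
    forall t', t' \in ts -> (P t' g <-> P t' y)].
  case: h => -[tg [y [Gy Dy ty hy]]]; exists y; split=> //.
    by rewrite ty.
  by rewrite ty; split.
apply: (HD y g Gy Gg _ Dy) => t'; rewrite inE => /predU1P[->//|ht'].
by rewrite hy.
Qed.

(* Only finitely many lattice vectors matter: a patch of large radius is never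
   empty, so it confines the internal coordinate to a bounded region. *)
Lemma determines_definable c (D : E -> Prop) :
  (forall i, bounded_set (W i)) -> (exists i, W i !=set0) ->
  determines c (in_window W s) D ->
  (exists u, forall g, G g -> D g -> `|pN g - s| <= u) -> definable D.
Proof.
move=> bW [i0 W0] dD [u Du].
have [w w0 Ww] := finite_family_bounded bW.
have W0' := regclosed_interior_neq0 (rW i0) W0.
have [r Hr] := lat_cover (open_interior (W i0)) W0'.
pose c' := Num.max c r.
(* If [x + h] is in the window, [pN h] is at most [w + |u|]. The internal part of [y] will only be
   known up to [2 * w + |u|], so there the bound is [3 * w + |u|]. *)
pose F := [set h | [/\ G h, `|pV h| <= c' & `|pN h| <= 3 * w + `|u|]].
have [hs hsF] : exists hs : seq E, F = [set` hs].
  by apply/finite_seqP; exact: lat_locally_finite.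
have FP h : h \in hs <-> F h by rewrite hsF.
pose ts := [seq (h, i) | h <- hs, i <- enum 'I_l].
apply: (@definable_finite _ ts (fun t x => in_window W s t.2 (x + t.1))).
  by move=> _ /allpairsP[[h i] [/= /FP[Gh _ _] _ ->]]; exact: definable_in_window.
move=> x y Gx Gy xy Dx.
have {}xy h i : F h -> in_window W s i (x + h) <-> in_window W s i (y + h).
  move=> /FP hF; apply: (xy (h, i)); apply/allpairsP; exists (h, i).
  by rewrite mem_enum.
apply/(dD x y Gx Gy); last exact: Dx.
have [g Gg [gr gW]] := Hr (pV x) s.
have nu : u <= `|u| by exact: ler_norm.
have xu := Du x Gx Dx.
have tri (a b : N) : `|b| <= `|a + b| + `|a|.
  by rewrite -{1}(addKr a b) addrC (le_trans (ler_normB _ _)).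
have wx h i : in_window W s i (x + h) -> `|pN h| <= w + `|u|.
  rewrite /in_window linearD/= addrAC => /Ww h1.
  by apply: (le_trans (tri (pN x - s) _)); rewrite lerD// (le_trans xu).
(* The patch at [x] contains [g]; agreement puts [y + (g - x)] in the window as well, which confines
   [pN y]. *)
have Fg : F (g - x).
  have h1 : in_window W s i0 (x + (g - x)).
    by rewrite addrC subrK; exact: interior_subset gW.
  split; [exact: latB|by rewrite linearB/= le_max gr orbT|].
  by apply: (le_trans (wx _ _ h1)); rewrite lerD2r; lra.
have yb : `|pN y - s| <= 2 * w + `|u|.
  have : in_window W s i0 (y + (g - x)).
    by apply/xy => //; rewrite addrC subrK; exact: interior_subset gW.
  have h1 : in_window W s i0 (x + (g - x)).
    by rewrite addrC subrK; exact: interior_subset gW.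
  have h2 := wx _ _ h1; rewrite /in_window linearD addrAC addrC => /Ww h3.
  by apply: (le_trans (tri (pN (g - x)) _)); lra.
move=> h Gh hc i.
have [hF|hF] := pselect (F h); first exact: xy.
have hN : ~ `|pN h| <= 3 * w + `|u|.
  by move=> hN; apply: hF; split=> //; rewrite le_max hc.
split; first by move=> /wx h1; exfalso; apply: hN; lra.
rewrite /in_window linearD/= addrAC => /Ww h1; exfalso; apply: hN.
by apply: (le_trans (tri (pN y - s) _)); lra.
Qed.

(** [U] and the set that defines [D] have the same trace up to the boundary of [U]. Both are regular
    closed, so density of the lattice makes them equal. *)
Lemma definable_sandwich D (U : set N) : regclosed U ->
  (forall g, G g -> U° (pN g - s) -> D g) ->
  (forall g, G g -> D g -> U (pN g - s)) ->
  definable D -> window_algebra W U.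
Proof.
move=> rU UD DU [U' hU' U'D]; have rU' := window_algebra_regclosed rW hU'.
suff -> : U = U' by [].
apply/seteqP; split.
  apply: (regclosed_subset (s := s) rU (regclosed_closed rU')) => g Gg /UD h.
  by apply/U'D => //; exact: h.
apply: (regclosed_subset (s := s) rU' (regclosed_closed rU)) => g Gg /interior_subset.
by move=> /U'D h; apply: DU => //; exact: h.
Qed.

(** The predicates [D j] are compared with [W' j] up to its boundary, so this applies before [W'] is
    known to be non-singular at [s]. *)
Lemma sandwich_constructable m (W' : 'I_m -> set N) (D : 'I_m -> E -> Prop) :
  (forall i, bounded_set (W i)) -> (exists i, W i !=set0) ->
  (forall j, regclosed (W' j)) -> (forall j, bounded_set (W' j)) ->
  (forall j, exists c, determines c (in_window W s) (D j)) ->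
  (forall j g, G g -> (W' j)° (pN g - s) -> D j g) ->
  (forall j g, G g -> D j g -> W' j (pN g - s)) ->
  constructable_from W' W.
Proof.
move=> bW W0 rW' bW' dD WD DW.
apply: window_algebra_ind; first exact: window_algebra_boolean.
move=> j h Gh; have shE x : pN x - s - pN h = pN (x - h) - s.
  by rewrite linearB/= addrAC.
apply: (@definable_sandwich (fun x => D j (x - h))).
- exact: translate_regclosed.
- move=> g Gg; rewrite translate_interior translateE shE; apply: WD; exact: latB.
- by move=> g Gg; rewrite translateE shE; apply: DW; exact: latB.
have [c dc] := dD j.
apply: (determines_definable bW W0 (determines_shift Gh dc)).
have /bounded_setP[u W'u] := translate_bounded (pN h) (bW' j).
exists u => g Gg Dg; apply: W'u; apply/translateE; rewrite shE.
by apply: DW => //; exact: latB.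
Qed.

End Definability.

(** * Patterns *)

Section PatternRelations.
Context (R : realType) (V : normedVectType R).

Lemma local_patchP l (P Q : 'I_l -> set V) x y (c : R) :
  local_patch P x c = local_patch Q y c <->
  forall i z, `|z| <= c -> (P i (x + z) <-> Q i (y + z)).
Proof.
have lpE (P' : 'I_l -> set V) x' i z :
    local_patch P' x' c i z <-> P' i (x' + z) /\ `|z| <= c.
  rewrite /local_patch translateE opprK addrC /closed_ball_ /=.
  by rewrite opprD addrA subrr add0r normrN.
split=> [PQ i z zc|PQ].
  have := lpE P x i z; rewrite PQ lpE => h.
  by split=> p; [have [] := h.2 (conj p zc)|have [] := h.1 (conj p zc)].
apply/funext => i; apply/seteqP; split=> z /lpE[h zc]; apply/lpE; split=> //; exact/PQ.
Qed.

Lemma locally_derivableP l m (Q : 'I_m -> set V) (P : 'I_l -> set V) :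
  locally_derivable Q P <-> exists2 c : R, 0 <= c & forall x y,
    (forall i z, `|z| <= c -> (P i (x + z) <-> P i (y + z))) -> forall j, Q j x <-> Q j y.
Proof.
split=> -[c c0 H]; exists c => // x y.
  move=> /local_patchP/H/local_patchP h j; have := h j 0.
  by rewrite normr0 lexx !addr0; exact.
move=> /local_patchP/H h; apply/local_patchP => j z; rewrite normr_le0 => /eqP ->.
by rewrite !addr0.
Qed.

Lemma LI_fromP l (P Q : 'I_l -> set V) :
  LI_from P Q <-> forall r : R, exists t, forall i x, `|x| <= r -> (Q i (x + t) <-> P i x).
Proof.
have tE t (A : set V) x : translate t A (x + t) <-> A x by rewrite translateE addrK.
split=> [PQ r|PQ U /bounded_setP[r Ur]].
  have [|t ht] := PQ [set x | `|x| <= r]; first by apply/bounded_setP; exists r.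
  exists t => i x xr; have := congr1 (fun f => f i (x + t)) ht.
  rewrite /Defs.patch /setI /= => eqt; split=> h.
    have : (Q i `&` translate t [set x | `|x| <= r]) (x + t) by split=> //; apply/tE.
    by rewrite /setI /= eqt => /tE[].
  by have := (tE t (P i `&` [set x | `|x| <= r]) x).2 (conj h xr); rewrite -eqt => -[].
have [t ht] := PQ r; exists t; apply/funext => i; apply/seteqP.
split=> x; rewrite -(subrK t x) /Defs.patch /setI /= !tE => -[h Ux].
  by split=> //; apply/ht => //; exact: Ur.
by split=> //; apply/ht => //; exact: Ur.
Qed.

Lemma LI_from_refl l (P : 'I_l -> set V) : LI_from P P.
Proof. by apply/LI_fromP => r; exists 0 => i x _; rewrite addr0. Qed.

Lemma LI_from_trans l (P Q Q' : 'I_l -> set V) :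
  LI_from P Q -> LI_from Q Q' -> LI_from P Q'.
Proof.
move=> /LI_fromP PQ /LI_fromP QQ'; apply/LI_fromP => r.
have [t ht] := PQ r; have [t' ht'] := QQ' (r + `|t|); exists (t + t') => i x xr.
rewrite addrA ht' ?ht//.
by rewrite (le_trans (ler_normD _ _))// lerD2r.
Qed.

Lemma LI_from_delone l (P Q : 'I_l -> set V) : LI_from Q P -> delone P -> delone Q.
Proof.
move=> /LI_fromP QP [[r r0 ud] [r' rd]]; split.
  exists r => // x y [i _ Qx] [j _ Qy] xy.
  have [t ht] := QP (Num.max `|x| `|y|).
  have := ud (x + t) (y + t).
  have -> : x + t - (y + t) = x - y by rewrite opprD addrACA subrr addr0.
  apply; last by apply: contra_neq xy => /addIr.
    by exists i => //; apply/ht => //; rewrite le_max lexx.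
  by exists j => //; apply/ht => //; rewrite le_max lexx orbT.
exists r' => x; have [t ht] := QP (`|x| + r').
have [y [i _ Py] xy] := rd (x + t).
have e : x - (y - t) = x + t - y by rewrite opprB addrA.
exists (y - t); last by rewrite e.
exists i => //; apply/ht; last by rewrite subrK.
rewrite -[y - t](subKr x) e (le_trans (ler_normB _ _))// lerD2l //.
Qed.

(** Recurrence is asked of the patch around the origin; as [r] is arbitrary, this covers every
    bounded patch. *)
Definition repetitive l (P : 'I_l -> set V) : Prop :=
  forall r : R, exists r' : R, forall x, exists2 t, `|t - x| <= r' &
    forall i z, `|z| <= r -> (P i (z + t) <-> P i z).

(** The patch of [Q] of radius [r + r'] occurs in [P] around [u], and within [r'] of [u] the central
    [r]-patch of [P] recurs; so [Q] contains it. *)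
Lemma repetitive_LI_sym l (P Q : 'I_l -> set V) :
  repetitive P -> LI_from Q P -> LI_from P Q.
Proof.
move=> rP /LI_fromP QP; apply/LI_fromP => r; have [r' hr'] := rP r.
have [u hu] := QP (r + r'); have [t tu ht] := hr' u.
exists (t - u) => i x xr; rewrite -hu; last first.
  by rewrite (le_trans (ler_normD _ _))// lerD.
by rewrite -addrA subrK ht.
Qed.

(* A local rule valid on L makes sense on every pattern locally
   indistinguishable from L. *)
Lemma MLD_transfer l m (P L : 'I_l -> set V) (L' : 'I_m -> set V) :
  LI_from P L -> MLD L L' -> exists P', LI_from P' L' /\ MLD P P'.
Proof.
move=> /LI_fromP PL [/locally_derivableP[c c0 LL'] /locally_derivableP[c' c'0 L'L]].
(* A point gets colour [j] if its [c']-patch in [P] is that of [L] at a point of colour [j] in [L'].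
   Wherever [L] copies [P] on a ball, [L'] then copies [P'] on the ball shrunk by [c']. *)
pose P' : 'I_m -> set V := fun j x => exists2 y, L' j y &
  forall i z, `|z| <= c' -> (P i (x + z) <-> L i (y + z)).
have P'E (r : R) t : (forall i x, `|x| <= r + c' -> (L i (x + t) <-> P i x)) ->
    forall j x, `|x| <= r -> L' j (x + t) <-> P' j x.
  move=> ht j x xr.
  have xt i z : `|z| <= c' -> (P i (x + z) <-> L i (x + t + z)).
    by move=> zc; rewrite addrAC ht// (le_trans (ler_normD _ _))// lerD.
  split=> [L'x|[y L'y xy]]; first by exists (x + t).
  apply/(L'L (x + t) y) => [i z zc|//].
  by rewrite -xt// xy.
exists P'; split; last split.
- apply/LI_fromP => r; have [t ht] := PL (r + c'); exists t => j x xr.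
  exact: (P'E r).
- apply/locally_derivableP; exists c => // x y xy j.
  have [t ht] := PL (Num.max `|x| `|y| + c + c').
  have P'L' := P'E _ _ ht.
  have le0 (a b d : R) : 0 <= b -> 0 <= d ->
      a <= Num.max `|x| `|y| -> a <= Num.max `|x| `|y| + b + d.
    by move=> b0 d0 h; rewrite -addrA (le_trans h)// lerDl addr_ge0.
  have xm : `|x| <= Num.max `|x| `|y| by rewrite le_max lexx.
  have ym : `|y| <= Num.max `|x| `|y| by rewrite le_max lexx orbT.
  rewrite -ht ?le0// -ht ?le0//; apply: LL' => i z zc.
  rewrite !(addrAC _ t) !P'L'; first exact: xy.
    by rewrite (le_trans (ler_normD _ _))// lerD.
  by rewrite (le_trans (ler_normD _ _))// lerD.
apply/locally_derivableP; exists c' => // x y xy j.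
split=> -[u L'u hu]; exists u => // i z zc.
  by rewrite -xy// hu.
by rewrite xy// hu.
Qed.

End PatternRelations.

(** * Return vectors and repetitivity of cut and project sets *)

Section CutAndProjectPatterns.
Context (R : realType) (E : normedVectType R) (S : cut_project_scheme E).

Notation V := (subvs_of (phys S)).
Notation N := (subvs_of (intl S)).
Notation pV := (pi_phys S).
Notation pN := (pi_intl S).
Notation G := (lat S).
Notation agree := (@agree R E S).
Notation determines := (@determines R E S).

Lemma cp_pattern_lat l (W : 'I_l -> set N) (s : N) i x : G x ->
  cp_pattern (shift_window s W) i (pV x) <-> in_window W s i x.
Proof.
move=> Gx; split=> [[y [Gy /translateE Wy] yx]|Wx].
  by rewrite -(lat_pi_phys_inj Gy Gx yx).
by exists x => //; split=> //; apply/translateE.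
Qed.

Lemma cp_pattern_in_lat l (W : 'I_l -> set N) i v :
  cp_pattern W i v -> exists2 x, G x & v = pV x.
Proof. by move=> [x [Gx _] <-]; exists x. Qed.

(** Local derivability compares arbitrary points of [V], [determines] only lattice points. If [x]
    carries a colour of [Q], a point [p] of [P] near [x] has a copy near [y], and this forces [y]
    into the projected lattice. *)
Lemma determines_derivable l m (P : 'I_l -> set V) (Q : 'I_m -> set V) (c : R) :
  relatively_dense (Defs.support P) ->
  (forall i v, P i v -> exists2 x, G x & v = pV x) ->
  (forall j v, Q j v -> exists2 x, G x & v = pV x) ->
  (forall j, determines c (fun i x => P i (pV x)) (fun x => Q j (pV x))) ->
  locally_derivable Q P.
Proof.
move=> [r rd] PG QG dQ; apply/locally_derivableP.
exists (Num.max 0 (Num.max c r)); first by rewrite le_max lexx.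
suff main x y : (forall i z, `|z| <= Num.max 0 (Num.max c r) -> (P i (x + z) <-> P i (y + z))) ->
    forall j, Q j x -> Q j y.
  move=> x y xy j; split; apply: main => // i z zc; by apply: iff_sym; exact: xy.
move=> xy j Qx; have [a Ga xa] := QG _ _ Qx.
have [p [i _ Pp] xp] := rd x; have [b Gb pb] := PG _ _ Pp.
have := Pp; rewrite -[p](subKr x) opprB xy; last first.
  by rewrite distrC !le_max xp !orbT.
move=> /PG[d Gd yd].
have Gy : G (d - b + a) by apply: latD => //; exact: latB.
have ya : y = pV (d - b + a).
  by rewrite linearD linearB/= -yd -pb -xa addrA [_ - x - p]addrAC addrK subrK.
rewrite ya; apply: (iffLR (dQ j a _ Ga Gy _)); last by rewrite -xa.
move=> h Gh hc k; rewrite !linearD/=; move: (xy k (pV h)).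
rewrite {1}xa ya !linearD /=; apply.
by rewrite !le_max hc orbT.
Qed.

(** The offsets [w] and [w'] place the two patterns relative to the projected lattice; recentring
    costs [|w' - w|] in the radius. *)
Lemma derivable_determines l m (P : 'I_l -> set V) (Q : 'I_m -> set V) (w w' : V) :
  (forall i v, P i v -> exists2 x, G x & v = pV x + w) ->
  locally_derivable Q P ->
  exists c, forall j, determines c (fun i x => P i (pV x + w)) (fun x => Q j (pV x + w')).
Proof.
move=> PG /locally_derivableP[c c0 QP]; exists (c + `|w' - w|) => j.
suff main x y : G x -> G y -> agree (c + `|w' - w|) (fun i x => P i (pV x + w)) x y ->
    forall i z, `|z| <= c -> P i (pV x + w' + z) -> P i (pV y + w' + z).
  move=> x y Gx Gy xy; apply: QP => i z zc; split; apply: main => //.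
  by move=> h Gh hc k; apply: iff_sym; exact: xy.
move=> Gx Gy xy i z zc Pz; have [b Gb eb] := PG _ _ Pz.
have hb : pV (b - x) = w' - w + z.
  rewrite linearB/=; apply/eqP; rewrite subr_eq; apply/eqP.
  apply: (addIr w); by rewrite -eb [RHS]addrAC [w' - w + z + w]addrAC subrK [RHS]addrC addrA.
have ey t : pV t + w' + z = pV (t + (b - x)) + w.
  by rewrite linearD/= hb -addrA -[RHS]addrA [w' - w + z + w]addrAC subrK.
rewrite ey; apply/(xy (b - x)); first exact: latB.
  by rewrite hb addrC (le_trans (ler_normD _ _))// lerD.
by rewrite -ey.
Qed.

Section Windows.
Context (l : nat) (W : 'I_l -> set N).
Hypothesis hW : is_window W.

Lemma window_regclosed i : regclosed (W i). Proof. by case: hW. Qed.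

Lemma window_bounded i : bounded_set (W i).
Proof. by case: hW => c _ _; exact: compact_bounded. Qed.

Lemma window_dense : exists r : R, forall (v : V) (s : N),
  exists2 g, G g & `|pV g - v| <= r /\ exists i, in_window W s i g.
Proof.
have [_ _ [i Wi]] := hW.
have [r Hr] := lat_cover (open_interior (W i))
  (regclosed_interior_neq0 (window_regclosed i) Wi).
exists r => v s; have [g Gg [gv gW]] := Hr v s; exists g => //; split=> //.
by exists i; exact: interior_subset gW.
Qed.

Lemma cp_relatively_dense s : relatively_dense (Defs.support (cp_pattern (shift_window s W))).
Proof.
have [r Hr] := window_dense; exists r => v; have [g Gg [gv [i gi]]] := Hr v s.
exists (pV g); last by rewrite distrC.
by exists i => //; exact/cp_pattern_lat.
Qed.

(** Two pattern points at distance at most 1 differ by a lattice vector with internal part at most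
    [w + w]. There are finitely many, and injectivity of [pV] on the lattice keeps the nonzero ones
    away from 0. *)
Lemma cp_uniformly_discrete s :
  uniformly_discrete (Defs.support (cp_pattern (shift_window s W))).
Proof.
have [w w0 Ww] := finite_family_bounded window_bounded.
pose F := [set g | [/\ G g, `|pV g| <= 1 & `|pN g| <= w + w]].
have fF : finite_set (F `\ 0) by apply: finite_setD; exact: lat_locally_finite.
have [|g [[Gg _ _] /eqP g0]|e e0 he] := @finite_set_pos_bound R _ _ (fun e g => e <= `|pV g|) fF.
- by move=> g e e' h1 h2; exact: le_trans h2 h1.
- exists `|pV g| => //; rewrite normr_gt0; apply: contra_neq g0 => h.
  by apply: lat_pi_phys_inj (lat0 S) _ => //; rewrite h linear0.
exists (Num.min 1 e); first by rewrite lt_min ltr01.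
move=> _ _ [i _ [x [Gx /translateE Wx] <-]] [j _ [y [Gy /translateE Wy] <-]] xy.
have [h|h] := leP `|pV x - pV y| 1; last by rewrite ge_min (ltW h).
rewrite ge_min; apply/orP; right; rewrite -linearB; apply: he; split.
  split; [exact: latB|by rewrite linearB|].
  rewrite linearB/=; have -> : pN x - pN y = (pN x - s) - (pN y - s).
    by rewrite opprB addrA subrK.
  by rewrite (le_trans (ler_normB _ _))// lerD//; [exact: Ww Wx|exact: Ww Wy].
by move=> /eqP; rewrite subr_eq0 => /eqP e1; rewrite e1 eqxx in xy.
Qed.

Lemma cp_delone s : delone (cp_pattern (shift_window s W)).
Proof. by split; [exact: cp_uniformly_discrete|exact: cp_relatively_dense]. Qed.

Lemma not_boundary_near (A : set N) p : ~ boundary A p ->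
  \forall q \near p, A q <-> A p.
Proof.
move=> nb; have [Ap|nAp] := pselect (A p).
  apply: filterS (interior_not_boundary nb Ap) => q Aq; split=> //.
have [cAp|ncAp] := pselect (closure A p).
  exfalso; apply: nb; split=> // /interior_subset//.
have : (~` A)° p by rewrite interiorC.
by apply: filterS => q nAq; split.
Qed.

(** Finitely many lattice points over the ball of radius [r] come near the window, and each is off
    its boundary. Beyond [w + 1 + |s|] a displacement shorter than 1 cannot reach the window. *)
Lemma in_window_stable s r : nonsingular (shift_window s W) ->
  exists2 e, 0 < e & forall x n i, G x -> `|pV x| <= r -> `|n| < e ->
    (W i (pN x - s + n) <-> in_window W s i x).
Proof.
move=> /nonsingularP ns; have [w w0 Ww] := finite_family_bounded window_bounded.
pose F := [set g | [/\ G g, `|pV g| <= r & `|pN g| <= w + 1 + `|s|]].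
have fF : finite_set F by exact: lat_locally_finite.
pose Q (e : R) g := forall i n, `|n| < e -> (W i (pN g - s + n) <-> in_window W s i g).
have [|g [Gg _ _]|e e0 he] := @finite_set_pos_bound R _ _ Q fF.
- by move=> g e e' h e'e i n /lt_le_trans/(_ e'e); exact: h.
- have h i : exists2 e, 0 < e & forall n, `|n| < e -> (W i (pN g - s + n) <-> in_window W s i g).
    have /nbhs_ballP[e e0 he] := not_boundary_near (ns g i Gg).
    exists e => // n ne; apply: he; rewrite -ball_normE /= opprD addrA subrr.
    by rewrite sub0r normrN.
  have [|i _|e e0 he] := @finite_set_pos_bound R 'I_l setT
      (fun e i => forall n, `|n| < e -> (W i (pN g - s + n) <-> in_window W s i g)) finite_finset.
  + by move=> i e e' h1 e'e n /lt_le_trans/(_ e'e); exact: h1.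
  + exact: h.
  + by exists e => // i; exact: he.
exists (Num.min 1 e); first by rewrite lt_min ltr01.
move=> x n i Gx xr; rewrite lt_min => /andP[n1 ne].
have [xw|xw] := leP `|pN x| (w + 1 + `|s|); first by apply: he.
have b (a c : N) : `|a - c| <= `|a| + `|c| by exact: ler_normB.
split=> [/Ww h|/Ww h]; exfalso.
  have := b (pN x - s + n) (n - s); rewrite opprB addrA [_ + n + s]addrAC subrK addrK => h1.
  have := b n s; lra.
have := b (pN x - s) (- s); rewrite opprK subrK normrN => h1.
lra.
Qed.

(** Moving by [g] changes the internal coordinate by [pN g], which nearly compensates the change of
    parameter. For [s' = s], lattice vectors of small internal part are return vectors. *)
Lemma cp_return s r : nonsingular (shift_window s W) ->
  exists2 e : R, 0 < e & forall s' g, G g -> `|pN g - (s' - s)| < e ->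
    forall i z, `|z| <= r -> (cp_pattern (shift_window s' W) i (z + pV g) <->
                              cp_pattern (shift_window s W) i z).
Proof.
move=> ns; have [e e0 he] := in_window_stable r ns; exists e => // s' g Gg gs i z zr.
have key x : G x -> `|pV x| <= r -> in_window W s' i (x + g) <-> in_window W s i x.
  move=> Gx xr; rewrite -(he x _ i Gx xr gs) /in_window linearD/=.
  by rewrite opprB !addrA (addrAC _ (- s)) -!addrA (addrA (- s)) addNr add0r !addrA.
split=> h.
  have [y Gy yz] := cp_pattern_in_lat h.
  have ze : z = pV (y - g) by rewrite linearB/= -yz addrK.
  have Gyg : G (y - g) by exact: latB.
  rewrite ze; apply/cp_pattern_lat => //; apply/key => //; first by rewrite -ze.
  by rewrite subrK; apply/cp_pattern_lat => //; rewrite -yz.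
have [y Gy yz] := cp_pattern_in_lat h.
rewrite yz -linearD; apply/cp_pattern_lat; first exact: latD.
apply/key => //; first by rewrite -yz.
by apply/cp_pattern_lat => //; rewrite -yz.
Qed.

Lemma cp_repetitive s : nonsingular (shift_window s W) ->
  repetitive (cp_pattern (shift_window s W)).
Proof.
move=> ns r; have [e e0 he] := cp_return r ns.
have [||r' hr'] := @lat_cover _ _ S (ball (0 : N) e); first exact: ball_open.
  by exists 0; exact: ballxx.
exists r' => x; have [g Gg [gx g0]] := hr' x 0; exists (pV g) => //.
move=> i z zr; apply: he => //; rewrite subrr.
by move: g0; rewrite -ball_normE /= sub0r normrN.
Qed.

Lemma cp_LI s s' : nonsingular (shift_window s W) ->
  LI_from (cp_pattern (shift_window s W)) (cp_pattern (shift_window s' W)).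
Proof.
move=> ns; apply/LI_fromP => r; have [e e0 he] := cp_return r ns.
have [g Gg gs] := lat_near (s' - s) e0.
by exists (pV g) => i z zr; exact: he.
Qed.

End Windows.
End CutAndProjectPatterns.

(** * From window constructability to substitution *)

Section SchemeExtension.
Context (R : realType) (E : normedVectType R) (S : cut_project_scheme E).

Notation V := (subvs_of (phys S)).
Notation N := (subvs_of (intl S)).
Notation pV := (pi_phys S).
Notation pN := (pi_intl S).
Notation G := (lat S).
Notation agree := (@agree R E S).
Notation determines := (@determines R E S).

Lemma restrict_endE (M : 'End(E)) (U : {vspace E}) u :
  (M @: U <= U)%VS -> vsval (restrict_end M U u) = M (vsval u).
Proof.
move=> MU; rewrite lfunE /= vsprojK//.
by apply: (subvP MU); exact/memv_img/subvsP.
Qed.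

Context (L : 'End(V)) (M : 'End(E)) (hM : scheme_extension L M).

Let A : 'End(N) := restrict_end M (intl S).

Lemma ext_val_phys v : vsval (L v) = M (vsval v).
Proof. by have [_ [MV ->] _] := hM; rewrite restrict_endE// MV. Qed.

Lemma ext_val_intl n : vsval (A n) = M (vsval n).
Proof. by have [_ _ MN] := hM; rewrite restrict_endE// MN. Qed.

Let decomp x : M x = vsval (L (pV x)) + vsval (A (pN x)).
Proof. by rewrite ext_val_phys ext_val_intl -linearD pi_decomp. Qed.

Lemma ext_pi_phys x : pV (M x) = L (pV x).
Proof. by rewrite decomp linearD/= pi_phys_val pi_phys_intl addr0. Qed.

Lemma ext_pi_intl x : pN (M x) = A (pN x).
Proof. by rewrite decomp linearD/= pi_intl_val pi_intl_phys add0r. Qed.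

Lemma ext_ker0 : lker M == 0%VS.
Proof.
have [_ [MV _] MN] := hM.
have := limg_ker_dim M fullv; rewrite capfv -(cps_add S) limgD MV MN.
by move=> /eqP; rewrite -[X in _ == X]add0n eqn_add2r dimv_eq0.
Qed.

Lemma ext_inj : injective M. Proof. exact/lker0P/ext_ker0. Qed.

Lemma ext_lat x : G x -> G (M x).
Proof. by case: hM => MG _ _ Gx; rewrite -MG; exists x. Qed.

Lemma ext_lat_surj y : G y -> exists2 x, G x & y = M x.
Proof. by case: hM => MG _ _; rewrite -{1}MG => -[x Gx <-]; exists x. Qed.

Lemma ext_intl_inj : injective A.
Proof.
by move=> n n' /(congr1 vsval); rewrite !ext_val_intl => /ext_inj/val_inj.
Qed.

Lemma ext_phys_inj : injective L.
Proof.
by move=> n n' /(congr1 vsval); rewrite !ext_val_phys => /ext_inj/val_inj.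
Qed.

Let A0 : lker A == 0%VS. Proof. exact/lker0P/ext_intl_inj. Qed.
Let AK : cancel A A^-1%VF. Proof. exact: lker0_lfunK. Qed.
Let AVK : cancel A^-1%VF A. Proof. exact: lker0_lfunVK. Qed.

Lemma ext_image_interior U : (A @` U)° = A @` U°.
Proof.
exact: (homeo_interior AK AVK (@lin_continuous _ _ _ _) (@lin_continuous _ _ _ _)).
Qed.

Lemma ext_image_closure U : closure (A @` U) = A @` closure U.
Proof.
exact: (homeo_closure AK AVK (@lin_continuous _ _ _ _) (@lin_continuous _ _ _ _)).
Qed.

Lemma ext_image_mem (U : set N) n : (A @` U) (A n) <-> U n.
Proof. by split=> [[m Um /ext_intl_inj <-]|Un]; [|exists n]. Qed.

Context (l : nat) (W : 'I_l -> set N) (hW : is_window W).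

Notation AW := (image_window A W).

Lemma ext_image_window : is_window AW.
Proof.
have [cW rW [i [n Wn]]] := hW; split=> [j|j|].
- by apply: continuous_compact => //; apply: continuous_subspaceT; exact: lin_continuous.
- by rewrite /regclosed ext_image_interior ext_image_closure rW.
- by exists i; exists (A n); exact/ext_image_mem.
Qed.

Lemma ext_in_window s i x : in_window AW (A s) i (M x) <-> in_window W s i x.
Proof. by rewrite /in_window /image_window ext_pi_intl -linearB ext_image_mem. Qed.

Lemma ext_nonsingular s :
  nonsingular (shift_window (A s) AW) <-> nonsingular (shift_window s W).
Proof.
have bE (U : set N) n : boundary (A @` U) (A n) <-> boundary U n.
  have e1 := ext_image_mem (closure U) n; have e2 := ext_image_mem U° n.
  rewrite /boundary ext_image_interior ext_image_closure.
  by split=> -[/e1 h1 h2]; split=> // /e2.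
split=> /nonsingularP ns; apply/nonsingularP => g i Gg.
  by rewrite -bE linearB/= -ext_pi_intl; apply: ns; exact: ext_lat.
have [h Gh ->] := ext_lat_surj Gg.
by rewrite ext_pi_intl -linearB bE; exact: ns.
Qed.

Lemma ext_intl_surj n : exists m, n = A m.
Proof. by exists (A^-1%VF n); rewrite AVK. Qed.

Lemma ext_phys_surj v : exists w, v = L w.
Proof. by exists (L^-1%VF v); rewrite lker0_lfunVK//; exact/lker0P/ext_phys_inj. Qed.

Lemma ext_cp_pattern s i v :
  cp_pattern (shift_window (A s) AW) i (L v) <-> cp_pattern (shift_window s W) i v.
Proof.
split=> h.
  have [y Gy vy] := cp_pattern_in_lat h; have [x Gx yx] := ext_lat_surj Gy.
  have vx : v = pV x by apply: ext_phys_inj; rewrite vy yx ext_pi_phys.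
  move: h; rewrite vy vx => /(cp_pattern_lat _ _ _ Gy) h.
  by apply/cp_pattern_lat => //; apply/ext_in_window; rewrite -yx.
have [x Gx vx] := cp_pattern_in_lat h; rewrite vx -ext_pi_phys.
apply/cp_pattern_lat; first exact: ext_lat.
by apply/ext_in_window/cp_pattern_lat => //; rewrite -vx.
Qed.

End SchemeExtension.

(** * Transport of the local rules to every pattern of the hull *)

Section ConstructableToSubstitutional.
Context (R : realType) (E : normedVectType R) (S : cut_project_scheme E).

Notation V := (subvs_of (phys S)).
Notation N := (subvs_of (intl S)).
Notation pV := (pi_phys S).
Notation pN := (pi_intl S).
Notation G := (lat S).
Notation agree := (@agree R E S).
Notation determines := (@determines R E S).

Lemma shift_window_shift l (W : 'I_l -> set N) (s t : N) :
  shift_window s (shift_window t W) = shift_window (s + t) W.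
Proof.
apply/funext => i; apply/seteqP; rewrite /shift_window.
by split=> n; rewrite !translateE opprD addrA.
Qed.

Lemma shift_is_window l (W : 'I_l -> set N) s : is_window W -> is_window (shift_window s W).
Proof.
move=> [cW rW [i [n Wn]]]; split=> [j|j|].
- apply: continuous_compact => //; apply: continuous_subspaceT.
  exact: continuous_translation.
- exact: translate_regclosed.
- by exists i; exists (n + s); exists n.
Qed.

Lemma eq_determines (c : R) l (X X' : 'I_l -> E -> Prop) (D D' : E -> Prop) :
  (forall i x, G x -> X i x <-> X' i x) -> (forall x, G x -> D x <-> D' x) ->
  determines c X D -> determines c X' D'.
Proof.
move=> XX' DD' dD x y Gx Gy xy; rewrite -!DD'//; apply: dD => // h Gh hc i.
by rewrite !XX'; [exact: xy|exact: latD|exact: latD].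
Qed.

Lemma cp_locally_derivable l m (W : 'I_l -> set N) (W' : 'I_m -> set N) (s s' : N) c :
  is_window W -> (forall j, determines c (in_window W s) (in_window W' s' j)) ->
  locally_derivable (cp_pattern (shift_window s' W')) (cp_pattern (shift_window s W)).
Proof.
move=> hW dW; apply: (determines_derivable (c := c)).
- exact: cp_relatively_dense.
- by move=> i v; exact: cp_pattern_in_lat.
- by move=> i v; exact: cp_pattern_in_lat.
move=> j; by apply: eq_determines (dW j) => [i x Gx|x Gx]; apply: iff_sym; exact: cp_pattern_lat.
Qed.

Lemma LI_from_preimage (L : 'End(V)) l (P Q : 'I_l -> set V) :
  (forall v, exists w, v = L w) -> LI_from P Q ->
  LI_from (fun i => L @^-1` P i) (fun i => L @^-1` Q i).
Proof.
move=> Ls /LI_fromP PQ; apply/LI_fromP => r; have [C C0 HC] := lin_bounded L.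
have [t ht] := PQ (C * r); have [u tu] := Ls t; exists u => i x xr.
by rewrite /preimage /= linearD/= -tu ht// (le_trans (HC x))// ler_pM2l.
Qed.

(** Constructability makes the patterns of [W + s] and [A(W) + (s + s0)] mutually derivable. The
    rules transfer to [P], and pulling the derived pattern back by [L] gives the witness. *)
Lemma mutually_constructable_LSub (L : 'End(V)) (M : 'End(E)) l (W : 'I_l -> set N)
    (s0 : N) (P : 'I_l -> set V) :
  is_window W -> scheme_extension L M ->
  mutually_constructable (shift_window (- s0) W)
    (image_window (restrict_end M (intl S)) W) ->
  cp_hull W P -> LSub L P.
Proof.
move=> hW hM WAW [s ns [dP PL]].
pose A := restrict_end M (intl S); pose AW := image_window A W.
have hAW : is_window AW := ext_image_window hM hW.
have hWs := shift_is_window (- s0) hW.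
have [c1 h1] : exists c, forall t, nonsingular (shift_window t (shift_window (- s0) W)) ->
    nonsingular (shift_window t AW) /\
    forall j, determines c (in_window (shift_window (- s0) W) t) (in_window AW t j).
  by apply: constructable_determines; [exact: window_regclosed|rewrite /constructable_from WAW].
have [c2 h2] : exists c, forall t, nonsingular (shift_window t AW) ->
    nonsingular (shift_window t (shift_window (- s0) W)) /\
    forall j, determines c (in_window AW t) (in_window (shift_window (- s0) W) t j).
  by apply: constructable_determines; [exact: window_regclosed|rewrite /constructable_from WAW].
have [|ns' d1] := h1 (s + s0); first by rewrite shift_window_shift addrK.
have [_ d2] := h2 _ ns'.
have sE : shift_window (s + s0) (shift_window (- s0) W) = shift_window s W.
  by rewrite shift_window_shift addrK.
have mld : MLD (cp_pattern (shift_window s W)) (cp_pattern (shift_window (s + s0) AW)).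
  by rewrite -sE; split; apply: cp_locally_derivable; eassumption.
have [P' [P'L MP]] := MLD_transfer PL mld.
(* With [s + s0 = A t], the pattern of [A(W) + (s + s0)] is the [L]-image of the pattern of
   [W + t]. *)
have [t st] := ext_intl_surj hM (s + s0).
have nst : nonsingular (shift_window t W) by apply/(ext_nonsingular hM); rewrite -st.
pose P'' : 'I_l -> set V := fun i => L @^-1` P' i.
have P''L : LI_from P'' (cp_pattern (shift_window t W)).
  have := LI_from_preimage (ext_phys_surj hM) P'L; congr (LI_from _ _).
  apply/funext => i; apply/seteqP; rewrite st.
  by split=> v /(ext_cp_pattern hM).
exists P''; split.
- exact: LI_from_delone P''L (cp_delone hW t).
- split.
    apply: (LI_from_trans P''L); apply: (LI_from_trans (cp_LI hW s nst)).
    by apply: repetitive_LI_sym => //; exact: cp_repetitive.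
  apply: (LI_from_trans PL); apply: (LI_from_trans (cp_LI hW t ns)).
  by apply: repetitive_LI_sym => //; exact: cp_repetitive.
suff -> : image_pattern L P'' = P' by case: MP.
apply/funext => i; apply/seteqP; split=> [_ [v Pv <-]//|v Pv].
by have [w vw] := ext_phys_surj hM v; exists w; rewrite /P'' /= -?vw.
Qed.

End ConstructableToSubstitutional.

(** * From substitution to window constructability *)

Section SubstitutionalToConstructable.
Context (R : realType) (E : normedVectType R) (S : cut_project_scheme E).

Notation V := (subvs_of (phys S)).
Notation N := (subvs_of (intl S)).
Notation pV := (pi_phys S).
Notation pN := (pi_intl S).
Notation G := (lat S).
Notation agree := (@agree R E S).
Notation determines := (@determines R E S).

Context (l : nat) (W : 'I_l -> set N) (hW : is_window W).

(** Each ball around a fixed point [p] of [P] occurs in the cut and project set and places [p] over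
    an internal coordinate in the compact set [W i0]. A cluster point of these coordinates, as the
    radius grows, is [- t]; only the window boundary stays undecided. *)
Lemma hull_sandwich s (P : 'I_l -> set V) : nonsingular (shift_window s W) ->
  Defs.support P !=set0 -> LI_from P (cp_pattern (shift_window s W)) ->
  exists v t, (forall i g, G g -> (W i)° (pN g - t) -> P i (pV g + v)) /\
    (forall i u, P i u -> exists2 g, G g /\ W i (pN g - t) & u = pV g + v).
Proof.
move=> ns [p [i0 _ Pp]] /LI_fromP PL.
have /choice[m hm] (n : nat) : exists m : N, W i0 m /\ (forall i z, `|z| <= n%:R ->
    P i (z + p) -> exists2 g, G g & z = pV g) /\ (forall i g, G g -> `|pV g| <= n%:R ->
    (P i (pV g + p) <-> W i (pN g + m))).
  have [t ht] := PL (n%:R + `|p|).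
  have pt : cp_pattern (shift_window s W) i0 (p + t) by apply/ht; rewrite // ler_wpDl.
  have [a Ga ta] := cp_pattern_in_lat pt.
  have key i z : `|z| <= n%:R -> (cp_pattern (shift_window s W) i (z + pV a) <-> P i (z + p)).
    by move=> zn; rewrite -ta addrA ht// (le_trans (ler_normD _ _))// lerD2r.
  exists (pN a - s); split; [|split].
  - by move: pt; rewrite ta => /(cp_pattern_lat _ _ _ Ga).
  - move=> i z zn /(key i z zn)/cp_pattern_in_lat[b Gb zb]; exists (b - a); first exact: latB.
    by rewrite linearB/= -zb addrK.
  - move=> i g Gg gn; rewrite -key// -linearD.
    have -> : pN g + (pN a - s) = pN (g + a) - s by rewrite linearD/= addrA.
    by apply: cp_pattern_lat; exact: latD.
have [cW _ _] := hW.
have [x hx] := compact_seq_cluster (cW i0) (fun n => (hm n).1).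
have ge n (r : R) : (Num.truncn r < n)%N -> r <= n%:R.
  by move=> rn; rewrite ltW// (lt_le_trans (truncnS_gt r))// ler_nat.
have cadd (n : N) : continuous (fun y : N => n + y).
  rewrite (_ : (fun y => _) = (fun y => y + n)); first exact: continuous_translation.
  by apply/funext => y; rewrite addrC.
exists p, (- x); split=> [i g Gg|i u Pu].
  rewrite opprK => /cadd /(hx _ (Num.truncn `|pV g|).+1)[n gn Wn].
  by apply/(hm n).2.2 => //; exact: ge.
have up : `|u - p| <= (Num.truncn `|u - p|).+1%:R by exact: ge.
have Pup : P i (u - p + p) by rewrite subrK.
have [g Gg ug] := (hm _).2.1 i _ up Pup.
exists g; last by rewrite -ug subrK.
split=> //; rewrite opprK; apply: contrapT => nW.
have oW : open (~` W i).
  by apply: closed_openC; apply: regclosed_closed; exact: window_regclosed.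
have : nbhs (pN g + x) (~` W i) by exact: open_nbhs_nbhs.
move=> /cadd /(hx _ (Num.truncn `|pV g|).+1)[n gn]; apply.
by apply/(hm n).2.2 => //; [exact: ge|rewrite -ug].
Qed.

Context (L : 'End(V)) (hL : bijective L) (s : N) (ns : nonsingular (shift_window s W)).

Notation Lam := (cp_pattern (shift_window s W)).

Lemma lin_lower_bound : exists2 c : R, 0 < c & forall v, `|v| <= c * `|L v|.
Proof.
have L0 : lker L == 0%VS by apply/lker0P; exact: bij_inj.
have [c c0 hc] := lin_bounded (L^-1)%VF; exists c => // v.
by have := hc (L v); rewrite /= lker0_lfunK.
Qed.

Section Extension.
Context (P : 'I_l -> set V) (v : V) (t : N).
Hypotheses (P0 : Defs.support P !=set0) (LP : LI_from Lam P).
Hypothesis PW : forall i u, P i u -> exists2 g, G g /\ W i (pN g - t) & u = pV g + v.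
Hypotheses (LQ : locally_derivable Lam (image_pattern L P))
           (QL : locally_derivable (image_pattern L P) Lam).

Let Linj : injective L. Proof. exact: bij_inj. Qed.

(** A lattice vector of small internal part is a return vector of [Lam], hence of the derived [L P],
    and so the [L]-image of a difference of points of [P]. Such vectors generate the lattice. *)
Lemma lat_phys_preimage g : G g -> exists2 h, G h & pV g = L (pV h).
Proof.
have /locally_derivableP[c c0 hc] := QL; have [u0 [i _ Pu0]] := P0.
have [e e0 he] := cp_return hW (`|L u0| + c) ns.
move: g; apply: (lat_generated e0) => [x y [x' Gx' xx'] [y' Gy' yy']|g Gg ge].
  by exists (x' + y'); [exact: latD|rewrite !linearD/= xx' yy'].
have [u1 Pu1 u1E] : image_pattern L P i (L u0 + pV g).
  apply: (iffLR (hc (L u0) _ _ i)); last by exists u0.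
  move=> j z zc; rewrite addrAC he//; first by rewrite subrr subr0.
  by rewrite (le_trans (ler_normD _ _))// lerD2l.
have [g0 [Gg0 _] u0g] := PW Pu0; have [g1 [Gg1 _] u1g] := PW Pu1.
exists (g1 - g0); first exact: latB.
have -> : pV (g1 - g0) = u1 - u0.
  by rewrite linearB/= u0g u1g opprD addrACA subrr addr0.
by rewrite linearB/= u1E addrC addKr.
Qed.

(** For small internal part, [pV g] repeats a patch of [Lam], which occurs in [P]. Then [L (pV g)]
    repeats a patch of [L P] and joins two points of the derived [Lam]; both lie over the window,
    whence [C]. *)
Lemma lat_phys_image_bounded : exists e C : R, 0 < e /\
  forall g, G g -> `|pN g| < e -> exists2 h, G h & pV h = L (pV g) /\ `|pN h| <= C.
Proof.
have /locally_derivableP[c c0 hc] := LQ.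
have [r Hr] := window_dense hW; have [k k0 hk] := lin_lower_bound.
have [w w0 Ww] := finite_family_bounded (window_bounded hW).
(* Vectors whose [L]-image has norm at most [r + c] have norm at most [rho]; [r] reaches a point of
   [Lam] and [c] is the derivation radius. *)
pose rho := k * (r + c).
have [e e0 he] := cp_return hW rho ns; exists e, (w + w); split=> // g Gg ge.
have [tau htau] := (LI_fromP _ _).1 LP (rho + `|pV g|).
have Pag i z : `|z| <= rho -> (P i (z + tau) <-> P i (z + pV g + tau)).
  move=> zr; rewrite !htau; first by rewrite he// subrr subr0.
    by rewrite (le_trans (ler_normD _ _))// lerD2r.
  by rewrite (le_trans zr)// lerDl.
have Qag i z : `|z| <= r + c ->
    (image_pattern L P i (L tau + z) <-> image_pattern L P i (L tau + L (pV g) + z)).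
  have [z' zz'] : exists z', z = L z' by case: hL => f _ fK; exists (f z); rewrite fK.
  move=> zr; have z'r : `|z'| <= rho.
    by rewrite (le_trans (hk z'))// -zz' ler_pM2l.
  have imE y : image_pattern L P i (L y) <-> P i y.
    by split=> [[y' Py' /Linj <-]//|Py]; exists y.
  have e2 : tau + pV g + z' = z' + pV g + tau by rewrite addrC addrA addrAC.
  by rewrite zz' -!linearD !imE e2 (addrC tau z') Pag.
have [a Ga [xa [i Wa]]] := Hr (L tau) s.
have Lama : Lam i (pV a) by exact/cp_pattern_lat.
have : Lam i (pV a + L (pV g)).
  apply: (iffLR (hc (pV a) _ _ i) Lama) => j z zc.
  have e1 : L tau + (pV a - L tau + z) = pV a + z by rewrite addrA [L tau + _]addrC subrK.
  have e2 : L tau + L (pV g) + (pV a - L tau + z) = pV a + L (pV g) + z.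
    by rewrite addrAC e1 addrAC.
  rewrite -e1 -e2; apply: Qag.
  by rewrite (le_trans (ler_normD _ _))// lerD.
move=> Lamb; have [b Gb ab] := cp_pattern_in_lat Lamb.
have Wb : in_window W s i b by apply/cp_pattern_lat => //; rewrite -ab.
exists (b - a); first exact: latB; split.
  by rewrite linearB/= -ab addrC addKr.
have -> : pN (b - a) = (pN b - s) - (pN a - s) by rewrite linearB/= opprB addrA subrK.
by rewrite (le_trans (ler_normB _ _))// lerD//; [exact: Ww Wb|exact: Ww Wa].
Qed.

Lemma lat_phys_image g : G g -> exists2 h, G h & pV h = L (pV g).
Proof.
have [e [C [e0 he]]] := lat_phys_image_bounded.
move: g; apply: (lat_generated e0) => [x y [x' Gx' xx'] [y' Gy' yy']|g Gg ge].
  by exists (x' + y'); [exact: latD|rewrite !linearD/= xx' yy'].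
by have [h Gh [hg _]] := he g Gg ge; exists h.
Qed.

Lemma scheme_extension_exists : exists M : 'End(E), scheme_extension L M.
Proof.
have [b bb HG] := lat_coordP S; pose n := \dim {:E}.
have Gb (i : 'I_n) : G b`_i.
  apply/HG; exists [ffun j => (j == i)%:Z].
  rewrite (bigD1 i)//= ffunE eqxx big1 ?addr0// => j /negPf ji.
  by rewrite ffunE ji.
have /choice[m hm] (i : 'I_n) : exists h, G h /\ pV h = L (pV b`_i).
  by have [h] := lat_phys_image (Gb i); exists h.
(* [m i] is a lattice vector over the [L]-image of the projected [i]-th basis vector. *)
pose f x := \sum_(i < n) coord b i x *: m i.
have f_linear : linear f.
  move=> a x y; rewrite /f scaler_sumr -big_split; apply: eq_bigr => i _ /=.
  by rewrite linearP scalerDl scalerA.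
pose fL := GRing.isLinear.Build _ _ _ _ f f_linear.
pose ff : {linear E -> E} := HB.pack f fL.
pose M : 'End(E) := linfun ff.
have ME x : M x = f x by rewrite lfunE.
have Mb (i : 'I_n) : M b`_i = m i.
  rewrite ME /f (bigD1 i)//= coord_free ?(basis_free bb)// eqxx scale1r.
  rewrite big1 ?addr0// => j /negPf ji.
  by rewrite coord_free ?(basis_free bb)// eq_sym ji scale0r.
have pVM x : pV (M x) = L (pV x).
  rewrite {2}(coord_basis bb (memvf x)) ME !linear_sum; apply: eq_bigr => i _.
  by rewrite !linearZ/= (hm i).2.
have GM x : G x -> G (M x).
  move=> /HG[a ->]; rewrite linear_sum.
  apply: (big_ind (fun x => G x)) => [|? ?|i _]; [exact: lat0|exact: latD|].
  rewrite raddfMz/= Mb; case: (a i) => k.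
    rewrite -pmulrn; elim: k => [|k IH]; first by rewrite mulr0n; exact: lat0.
    by rewrite mulrS; apply: latD => //; exact: (hm i).1.
  rewrite NegzE mulrNz -pmulrn; apply: latN; elim: k => [|k IH].
    by rewrite mulr1n; exact: (hm i).1.
  by rewrite mulrS; apply: latD => //; exact: (hm i).1.
have MG : M @` G = G.
  apply/seteqP; split=> [_ [x Gx <-]|y Gy]; first exact: GM.
  have [x Gx yx] := lat_phys_preimage Gy; exists x => //.
  by apply: lat_pi_phys_inj; [exact: GM|exact: Gy|rewrite pVM].
have Msurj : limg M = fullv.
  apply/eqP; rewrite eqEsubv subvf -[X in (X <= _)%VS](span_basis bb).
  apply/span_subvP => x /tnthP[i ->].
  rewrite (tnth_nth 0); move: (Gb i); rewrite -{1}MG => -[y Gy <-].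
  by apply: memv_img; exact: memvf.
have M0 : lker M == 0%VS.
  have := limg_ker_dim M fullv; rewrite capfv Msurj => /eqP.
  by rewrite -[X in _ == X]add0n eqn_add2r dimv_eq0.
(* [M] is injective, so an invariant subspace is mapped onto itself by dimension. *)
have Mdim (U : {vspace E}) : (M @: U <= U)%VS -> (M @: U)%VS = U.
  move=> MU; apply/eqP; rewrite eqEdim MU limg_dim_eq ?leqnn//.
  by rewrite (eqP M0) capv0.
have MN : (M @: intl S)%VS = intl S.
  apply: Mdim; apply/subvP => _ /memv_imgP[x xN ->].
  rewrite -(pi_decomp S (M x)) pVM.
  have -> : pV x = 0 by rewrite -(vsprojK xN) pi_phys_intl.
  by rewrite linear0 add0r subvsP.
(* [T] is the block of [M] from physical to internal space, [A] the internal block. *)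
pose T : {linear V -> N} := pN \o M \o vsval.
pose A : {linear N -> N} := pN \o M \o vsval.
have TA x : pN (M x) = T (pV x) + A (pN x).
  by rewrite /T /A /= -!linearD pi_decomp.
have [e [C [e0 he]]] := lat_phys_image_bounded.
have [CT CT0 hT] := lin_bounded T; have [CA CA0 hA] := lin_bounded A.
have [||r Hr] := @lat_cover _ _ S (ball (0 : N) e); first exact: ball_open.
  by exists 0; exact: ballxx.
(* Near every [u] lies some [pV g] with [pN g] short; then [pN (M g)] and [A (pN g)] are bounded, so
   [T] takes bounded values on all of [V]. *)
have T0 : forall v, T v = 0.
  apply: (@bounded_linear_eq0 R _ _ T (C + CA * e + CT * r)) => u.
  have [g Gg [gu gb]] := Hr u 0.
  have ge : `|pN g| < e by move: gb; rewrite subr0 -ball_normE /= sub0r normrN.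
  have [h Gh [hg hC]] := he g Gg ge.
  have hM : h = M g.
    by apply: lat_pi_phys_inj; [exact: Gh|exact: GM|rewrite hg pVM].
  have -> : T u = pN h - A (pN g) - T (pV g - u).
    by rewrite hM TA addrK linearB/= subKr.
  rewrite (le_trans (ler_normB _ _))// lerD//.
    rewrite (le_trans (ler_normB _ _))// lerD// (le_trans (hA _))// ler_pM2l// ltW//.
  by rewrite (le_trans (hT _))// ler_pM2l.
have MV' u : M (vsval u) = vsval (L u).
  rewrite -[LHS](pi_decomp S) pVM pi_phys_val.
  by have := T0 u; rewrite /T /= => ->; rewrite addr0.
have MV : (M @: phys S)%VS = phys S.
  apply: Mdim; apply/subvP => _ /memv_imgP[x xV ->].
  by rewrite -(vsprojK xV) MV' subvsP.
exists M; split=> //; split=> //.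
by apply/lfunP => u; apply: val_inj; rewrite /= restrict_endE ?MV// MV'.
Qed.

End Extension.

End SubstitutionalToConstructable.

(** * From mutual derivability to equal window algebras *)

Section SubstitutionalConverse.
Context (R : realType) (E : normedVectType R) (S : cut_project_scheme E).

Notation V := (subvs_of (phys S)).
Notation N := (subvs_of (intl S)).
Notation pV := (pi_phys S).
Notation pN := (pi_intl S).
Notation G := (lat S).
Notation determines := (@determines R E S).

(* The window of LP' is determined only up to its boundary at first.  Once it is
   constructable from W, non-singularity of W + s shows that the lattice misses
   that boundary, and the roles of the two patterns can be exchanged. *)
Lemma MLD_mutually_constructable (L : 'End(V)) (M : 'End(E)) l (W : 'I_l -> set N)
    (s t : N) (v : V) (P : 'I_l -> set V) (A := restrict_end M (intl S)) :
  is_window W -> scheme_extension L M -> nonsingular (shift_window s W) ->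
  (forall i g, G g -> (W i)° (pN g - t) -> P i (pV g + v)) ->
  (forall i u, P i u -> exists2 g, G g /\ W i (pN g - t) & u = pV g + v) ->
  MLD (image_pattern L P) (cp_pattern (shift_window s W)) ->
  mutually_constructable (shift_window (s - A t) W) (image_window A W).
Proof.
move=> hW hM ns WP PW [QL LQ].
have hAW := ext_image_window hM hW; have hW0 := shift_is_window (s - A t) hW.
set W0 := shift_window (s - A t) W in hW0 *; set AW := image_window A W in hAW *.
have ns0 : nonsingular (shift_window (A t) W0).
  by rewrite /W0 shift_window_shift addrC subrK.
have W0E i x : in_window W0 (A t) i x <-> in_window W s i x.
  by rewrite in_window_shift addrC subrK.
(* The points of [L P] lie in the projected lattice moved by [L v]; [D] reads them on the
   lattice. *)
pose D i x := image_pattern L P i (pV x + L v).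
have AWD j g : G g -> (AW j)° (pN g - A t) -> D j g.
  move=> Gg; have [h Gh ->] := ext_lat_surj hM Gg.
  rewrite /AW /image_window (ext_image_interior hM) (ext_pi_intl hM) -linearB.
  move=> /(ext_image_mem hM)/(WP _ _ Gh) Ph.
  by exists (pV h + v) => //; rewrite linearD/= -(ext_pi_phys hM).
have DAW j g : G g -> D j g -> AW j (pN g - A t).
  move=> Gg [_ /PW[h [Gh Wh] ->]]; rewrite linearD/= -(ext_pi_phys hM) => /addIr hg.
  rewrite -(lat_pi_phys_inj (ext_lat hM Gh) Gg hg) (ext_pi_intl hM) -linearB.
  exact/(ext_image_mem hM).
have cAW : constructable_from AW W0.
  apply: (sandwich_constructable _ ns0 _ _ _ _ _ AWD DAW).
  - exact: window_regclosed.
  - exact: window_bounded.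
  - by case: hW0.
  - exact: window_regclosed.
  - exact: window_bounded.
  have LamG i u : cp_pattern (shift_window s W) i u -> exists2 x, G x & u = pV x + 0.
    by move=> /cp_pattern_in_lat[x Gx ->]; exists x; rewrite // addr0.
  have [c hc] := derivable_determines (L v) LamG QL.
  move=> j; exists c; apply: eq_determines (hc j) => // i x Gx.
  by rewrite addr0 cp_pattern_lat// W0E.
have [c0 /(_ _ ns0)[nsA _]] := constructable_determines (window_regclosed hW0) cAW.
have DE j x : G x -> D j x <-> in_window AW (A t) j x.
  move=> Gx; split=> [/(DAW _ _ Gx)//|AWx]; apply: AWD => //.
  by apply: interior_not_boundary AWx; move/nonsingularP: nsA; exact.
apply/seteqP; split; last exact: cAW.
apply: (sandwich_constructable (s := A t) (D := in_window W0 (A t)) _ nsA).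
- exact: window_regclosed.
- exact: window_bounded.
- by case: hAW.
- exact: window_regclosed.
- exact: window_bounded.
- have QG i u : image_pattern L P i u -> exists2 x, G x & u = pV x + L v.
    move=> [_ /PW[h [Gh _] ->] <-]; exists (M h); first exact: (ext_lat hM).
    by rewrite (ext_pi_phys hM) -linearD.
  have [c hc] := derivable_determines 0 QG LQ.
  move=> j; exists c; apply: eq_determines (hc j) => [i x Gx|x Gx]; first exact: DE.
  by rewrite addr0 cp_pattern_lat// W0E.
- by move=> j g _; exact: interior_subset.
- by [].
Qed.

Lemma LSub_mutually_constructable (L : 'End(V)) l (W : 'I_l -> set N) s :
  is_window W -> bijective L -> nonsingular (shift_window s W) ->
  LSub L (cp_pattern (shift_window s W)) ->
  exists M : 'End(E), scheme_extension L M /\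
    exists s0, mutually_constructable (shift_window (- s0) W)
      (image_window (restrict_end M (intl S)) W).
Proof.
move=> hW hL ns [P [[_ [r rd]] [PL LP] mld]].
have P0 : Defs.support P !=set0 by have [x Px _] := rd 0; exists x.
have [v [t [WP PW]]] := hull_sandwich hW ns P0 PL.
have [QL LQ] := mld.
have [M hM] := scheme_extension_exists hW hL ns P0 LP PW LQ QL.
exists M; split=> //; exists (restrict_end M (intl S) t - s).
by rewrite opprB; exact: (MLD_mutually_constructable hW hM ns WP PW mld).
Qed.

End SubstitutionalConverse.

(** * Expansive maps *)

Section RowNorm.
Context (K : numFieldType) (m : nat).
Implicit Types (u v : 'rV[K]_m).

(** The sum norm has values in the scalar field itself, so it can be used over [R[i]]. *)
Definition row_norm u : K := \sum_j `|u 0 j|.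

Lemma row_norm_ge0 u : 0 <= row_norm u. Proof. exact: sumr_ge0. Qed.

Lemma row_norm0 : row_norm 0 = 0.
Proof. by rewrite /row_norm big1// => j _; rewrite mxE normr0. Qed.

Lemma row_normZ a u : row_norm (a *: u) = `|a| * row_norm u.
Proof. by rewrite /row_norm mulr_sumr; apply: eq_bigr => j _; rewrite mxE normrM. Qed.

Lemma row_normB u v : row_norm (u - v) <= row_norm u + row_norm v.
Proof.
by rewrite /row_norm -big_split; apply: ler_sum => j _; rewrite !mxE ler_normB.
Qed.

Lemma row_norm_gt0 u : u != 0 -> 0 < row_norm u.
Proof.
move=> u0; rewrite lt_neqAle row_norm_ge0 andbT eq_sym psumr_neq0; last by move=> j _.
apply/hasP; apply: contrapT => nh; move/eqP: u0; apply; apply/rowP => j; rewrite mxE.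
apply/eqP; rewrite -normr_le0; apply: contrapT => uj; apply: nh; exists j => //=.
  by rewrite mem_index_enum.
by rewrite normr_gt0 -normr_le0; exact/negP.
Qed.

(* Backward orbits of B: dividing out one linear factor (B - z) of an
   annihilating polynomial turns x into y with y (n+1) = x n - z x (n+1), and
   |z| > 1 lets the sum of y control the sum of x. *)
Lemma backward_orbit_summable (B : 'M[K]_m) (zs : seq K) (x : nat -> 'rV[K]_m) :
  (forall n, x n.+1 *m B = x n) -> (forall z, z \in zs -> 1 < `|z|) ->
  (forall n, x n *m foldr (fun z P => (B - z%:M) *m P) 1%:M zs = 0) ->
  exists C, forall n, \sum_(k < n) row_norm (x k) <= C.
Proof.
elim: zs x => [|z zs IH] x xB hzs h0.
  exists 0 => n; rewrite big1// => k _; have := h0 k; rewrite /= mulmx1 => ->.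
  exact: row_norm0.
pose y n := x n *m (B - z%:M).
have yE n : y n.+1 = x n - z *: x n.+1 by rewrite /y mulmxBr xB mul_mx_scalar.
have [||C hC] := IH y _ (fun z' h => hzs z' (mem_behead (s := z :: zs) h)).
- by move=> n; rewrite yE /y !(mulmxBr, mulmxBl) -scalemxAl !xB mul_mx_scalar.
- by move=> n; rewrite /y -mulmxA; exact: h0.
have z1 : 1 < `|z| by apply: hzs; rewrite inE eqxx.
have z10 : 0 < `|z| - 1 by rewrite subr_gt0.
have Smono n : \sum_(k < n) row_norm (x k) <= \sum_(k < n.+1) row_norm (x k).
  by rewrite big_ord_recr/= lerDl row_norm_ge0.
exists ((`|z| * row_norm (x 0%N) + C) / (`|z| - 1)) => n.
apply: (le_trans (Smono n)); rewrite ler_pdivlMr// mulrBr mulr1 lerBlDr.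
have -> : (\sum_(k < n.+1) row_norm (x k)) * `|z| =
    `|z| * row_norm (x 0%N) + \sum_(k < n) row_norm (z *: x k.+1).
  rewrite mulrC big_ord_recl mulrDr; congr (_ + _); rewrite mulr_sumr.
  by apply: eq_bigr => k _; rewrite row_normZ.
rewrite -addrA lerD2l.
apply: (@le_trans _ _ (\sum_(k < n) (row_norm (x k) + row_norm (y k.+1)))).
  apply: ler_sum => k _.
  have -> : z *: x k.+1 = x k - y k.+1 by rewrite yE subKr.
  exact: row_normB.
rewrite big_split/= addrC lerD ?Smono//.
by apply: le_trans (hC n.+1); rewrite big_ord_recl/= lerDr row_norm_ge0.
Qed.

End RowNorm.

(** Cayley-Hamilton with the characteristic polynomial split into linear factors; the fold lets them
    be peeled off one at a time. *)
Lemma eigenvalue_annihilator (K : closedFieldType) m (B : 'M[K]_m) :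
  exists2 zs : seq K, (forall z, z \in zs -> eigenvalue B z) &
    foldr (fun z P => (B - z%:M) *m P) 1%:M zs = 0.
Proof.
case: m B => [|m] B; first by exists [::] => //; exact: flatmx0.
have [zs hzs] := closed_field_poly_normal (char_poly B).
rewrite (monicP (char_poly_monic B)) scale1r in hzs.
exists zs => [z zzs|].
  by rewrite eigenvalue_root_char hzs root_prod_XsubC.
rewrite -(Cayley_Hamilton B) hzs rmorph_prod.
elim: zs {hzs} => [|z zs IH] /=; first by rewrite big_nil.
by rewrite big_cons IH rmorphB/= horner_mx_X horner_mx_C.
Qed.

Section SpectralGrowth.
Context (R : realType) (V : normedVectType R).

Let n : nat := \dim {:V}.
Let b : n.-tuple V := vbasis {:V}.
Let co : V -> 'rV[R]_n := rVof b.
Let bP : basis_of {:V} b. Proof. exact: vbasisP. Qed.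

Let cx (u : 'rV[R]_n) : 'rV[R[i]]_n := map_mx (real_complex R) u.

Let mx (f : 'End(V)) : 'M[R[i]]_n := map_mx (real_complex R) (mxof b b f).

Let cx_app f v : cx (co v) *m mx f = cx (co (f v)).
Proof. by rewrite /cx /mx -map_mxM /co (@rVof_app _ _ _ _ _ bP). Qed.

Let row_norm_cx u : row_norm (cx u) = (\sum_j `|u 0 j|)%:C%C.
Proof.
rewrite /row_norm rmorph_sum; apply: eq_bigr => j _.
by rewrite mxE normc_def/= expr0n addr0 sqrtr_sqr.
Qed.

Let norm_le_co : exists2 C : R, 0 <= C & forall v, `|v| <= C * \sum_j `|co v 0 j|.
Proof.
have [C C0 hC] := norm_le_coord V; exists C => // v; apply: (le_trans (hC v)).
by rewrite ler_wpM2l//; apply: ler_sum => j _; rewrite coord_rVof.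
Qed.

Let co_le_norm : exists2 C : R, 0 < C & forall v, \sum_j `|co v 0 j| <= C * `|v|.
Proof.
have [C C0 hC] := coord_le_norm V; exists C => // v; apply: le_trans (hC v).
by apply: ler_sum => j _; rewrite coord_rVof.
Qed.

(** [kappa k] bounds the [k]-th inverse power. In complex coordinates the inverse iterates of a
    basis vector form a backward orbit of a matrix with all eigenvalues outside the unit disc, hence
    are summable. *)
Lemma expansive_summable (f : 'End(V)) : lker f == 0%VS -> expansive f ->
  exists kappa : nat -> R, [/\ forall k, 0 <= kappa k,
    forall k v, `|iter k f^-1%VF v| <= kappa k * `|v| &
    exists C, forall m, \sum_(k < m) kappa k <= C].
Proof.
move=> f0 ef; have [zs hzs hB] := eigenvalue_annihilator (mx f).
have [C1 C10 h1] := norm_le_co; have [C2 C20 h2] := co_le_norm.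
have hb (i : 'I_n) : exists2 C : R, 0 <= C & forall k, \sum_(j < k) `|iter j f^-1%VF b`_i| <= C.
  pose x k := cx (co (iter k f^-1%VF b`_i)).
  have [k||k|C hC] := @backward_orbit_summable _ _ (mx f) zs x.
  - by rewrite /x cx_app /= lker0_lfunVK.
  - by move=> z /hzs/ef.
  - by rewrite hB mulmx0.
  (* The bound [C] lives in [R[i]]; its real part bounds the real sums. *)
  exists (C1 * complex.Re C).
    apply: mulr_ge0 => //; have := hC 0%N; rewrite big_ord0 lecE => /andP[_]; exact.
  move=> k; have := hC k.
  have -> : \sum_(j < k) row_norm (x j) =
      (\sum_(j < k) \sum_i0 `|co (iter j f^-1%VF b`_i) 0 i0|)%:C%C.
    by rewrite rmorph_sum; apply: eq_bigr => j _; rewrite row_norm_cx.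
  rewrite lecE => /andP[_ /= h]; apply: (@le_trans _ _ _ _ _ _ (ler_wpM2l C10 h)).
  by rewrite mulr_sumr; apply: ler_sum => j _; exact: h1.
pose c i := s2val (cid2 (hb i)).
have c0 i : 0 <= c i by rewrite /c; case: cid2.
have cP (i : 'I_n) k : \sum_(j < k) `|iter j f^-1%VF b`_i| <= c i by rewrite /c; case: cid2.
exists (fun k => (\sum_(i < n) `|iter k f^-1%VF b`_i|) * C2); split.
- by move=> k; apply: mulr_ge0; [exact: sumr_ge0|exact: ltW].
- move=> k v; rewrite -mulrA.
  have -> : iter k f^-1%VF v = \sum_(i < n) coord b i v *: iter k f^-1%VF b`_i.
    elim: k => [|k IH]; first by rewrite /= {1}(coord_basis bP (memvf v)).
    by rewrite /= IH linear_sum; apply: eq_bigr => i _; rewrite linearZ.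
  apply: (le_trans (ler_norm_sum _ _ _)).
  apply: (@le_trans _ _ ((\sum_(i < n) `|iter k f^-1%VF b`_i|) * \sum_j `|co v 0 j|)).
    rewrite mulr_suml; apply: ler_sum => i _; rewrite normrZ mulrC coord_rVof.
    by rewrite ler_wpM2l// (bigD1 i)//= lerDl; exact: sumr_ge0.
  by rewrite ler_wpM2l//; exact: sumr_ge0.
exists ((\sum_i c i) * C2) => m; rewrite -mulr_suml ler_wpM2r//; first exact: ltW.
by rewrite exchange_big/=; apply: ler_sum => i _; exact: cP.
Qed.

(** A complex eigenvector [u] is a complex combination of real basis vectors, on which some iterate
    is small. So [z ^+ k] shrinks [u] by at least one half. *)
Lemma iter_small_contractive (f : 'End(V)) :
  (forall d : R, 0 < d -> exists k, forall v, `|iter k f v| <= d * `|v|) ->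
  contractive f.
Proof.
move=> fs z /eigenvalueP[u uz u0].
have [C C0 hC] := co_le_norm.
pose s := \sum_(i < n) `|b`_i| + 1.
have s0 : 0 < s by rewrite ltr_wpDl// sumr_ge0.
(* This factor brings the coordinate norm of the [k]-th image of every basis vector down to one
   half. *)
have [k hk] := fs (2 * C * s)^-1 ltac:(by rewrite invr_gt0 !mulr_gt0).
have uE j : z ^+ j *: u = \sum_(i < n) u 0 i *: cx (co (iter j f b`_i)).
  elim: j => [|j IH].
    rewrite expr0 scale1r [LHS]row_sum_delta; apply: eq_bigr => i _.
    congr (_ *: _); rewrite /cx /co /= rVofE//.
    by apply/matrixP => p q; rewrite !mxE; case: (_ && _); rewrite ?rmorph1 ?rmorph0.
  rewrite exprSr -scalerA -uz scalemxAl IH mulmx_suml; apply: eq_bigr => i _.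
  by rewrite -scalemxAl cx_app.
have un : 0 < row_norm u by exact: row_norm_gt0.
have small (i : 'I_n) : row_norm (cx (co (iter k f b`_i))) <= (2^-1)%:C%C.
  rewrite row_norm_cx lecR (le_trans (hC _))//.
  apply: (@le_trans _ _ (C * ((2 * C * s)^-1 * s))).
    rewrite ler_pM2l// (le_trans (hk _))// ler_pM2l ?invr_gt0 ?mulr_gt0//.
    rewrite /s (bigD1 i)//= -addrA lerDl addr_ge0// sumr_ge0//.
  by rewrite le_eqVlt; apply/orP; left; apply/eqP; field; rewrite !gt_eqF.
have main : `|z| ^+ k * row_norm u <= (2^-1)%:C%C * row_norm u.
  rewrite -normrX -row_normZ uE.
  apply: (@le_trans _ _ (\sum_(i < n) row_norm (u 0 i *: cx (co (iter k f b`_i))))).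
    rewrite /row_norm exchange_big/=; apply: ler_sum => j _.
    rewrite summxE; exact: ler_norm_sum.
  rewrite {2}/row_norm mulr_sumr; apply: ler_sum => i _.
  by rewrite row_normZ mulrC ler_wpM2r.
rewrite real_ltNge ?normr_real ?real1//; apply/negP => z1.
have := exprn_ege1 k z1; move: main; rewrite ler_pM2r// => h1 h2.
have := le_trans h2 h1; rewrite -(rmorph1 (real_complex R)) lecR; lra.
Qed.

End SpectralGrowth.

(** * Recognizability *)

Lemma summable_small (R : realType) (kappa : nat -> R) (C e : R) :
  (forall m, \sum_(k < m) kappa k <= C) -> 0 < e -> exists k, kappa k <= e.
Proof.
move=> hC e0; apply: contrapT => nk.
have ek k : e <= kappa k by rewrite leNgt; apply/negP => /ltW h; apply: nk; exists k.
have := hC (Num.truncn (C / e)).+1; apply/negP; rewrite -ltNge.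
apply: (@lt_le_trans _ _ (\sum_(k < (Num.truncn (C / e)).+1) e)).
  by rewrite sumr_const card_ord -mulr_natl -ltr_pdivrMr// truncnS_gt.
by apply: ler_sum => k _.
Qed.

Lemma iter_lfunD (R : realType) (V : vectType R) (f : 'End(V)) k x y :
  iter k f (x + y) = iter k f x + iter k f y.
Proof. by elim: k => //= k ->; rewrite linearD. Qed.

Lemma iter_lfunB (R : realType) (V : vectType R) (f : 'End(V)) k x y :
  iter k f (x - y) = iter k f x - iter k f y.
Proof. by elim: k => //= k ->; rewrite linearB. Qed.

Lemma iter_lfunZ (R : realType) (V : vectType R) (f : 'End(V)) k (a : R) x :
  iter k f (a *: x) = a *: iter k f x.
Proof. by elim: k => //= k ->; rewrite linearZ. Qed.

Lemma iter_bounded (R : realType) (V : normedVectType R) (f : 'End(V)) k :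
  exists2 C : R, 0 < C & forall x, `|iter k f x| <= C * `|x|.
Proof.
have [C C0 hC] := lin_bounded f; elim: k => [|k [D D0 hD]]; first by exists 1 => // x; rewrite mul1r.
exists (C * D); first exact: mulr_gt0.
by move=> x /=; rewrite (le_trans (hC _))// -mulrA ler_pM2l.
Qed.

Lemma increasing_setsystem_stable (T : finType) (F : nat -> {set T}) :
  (forall n, F n \subset F n.+1) -> exists n, F n = F n.+1.
Proof.
move=> Fsub; apply: contrapT => nF.
have card n : (n <= #|F n|)%N.
  elim: n => // n IH; apply: (leq_ltn_trans IH); apply: proper_card.
  by rewrite finset.properEneq Fsub andbT; apply/eqP => h; apply: nF; exists n.
by have := leq_trans (card #|T|.+1) (max_card _); rewrite ltnn.
Qed.

(** * Iterated derivation along the inflation *)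

Section Recurrence.
Context (R : realType) (E : normedVectType R) (S : cut_project_scheme E).

Notation V := (subvs_of (phys S)).
Notation N := (subvs_of (intl S)).
Notation pV := (pi_phys S).
Notation pN := (pi_intl S).
Notation G := (lat S).
Notation agree := (@agree R E S).
Notation determines := (@determines R E S).

Context (l : nat) (W : 'I_l -> set N) (hW : is_window W).

Lemma agree_sym c m (X : 'I_m -> E -> Prop) x y : agree c X x y -> agree c X y x.
Proof. by move=> xy h Gh hc i; apply: iff_sym; exact: xy. Qed.

(* A window point where f is nearly maximal cannot be moved inside the window by
   a vector on which f is larger than the gap. *)
Lemma agree_functional (f : {linear N -> R^o}) (e : R) : 0 < e ->
  exists r : R, forall (v : N) x y, G x -> G y -> agree r (in_window W v) x y ->
    f (pN x - pN y) <= e.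
Proof.
move=> e0; have [cW rW [i W0]] := hW.
have cf : {within W i, continuous (f : N -> R)}.
  by apply: continuous_subspaceT; exact: lin_continuous.
have [p + pmax] := compact_EVT_max W0 (cW i) cf; rewrite inE => Wp.
pose O := (W i)° `&` [set n | f p - e < f n].
have oO' : open [set n : N | f p - e < f n].
  by apply: (open_comp (f := (f : N -> R)) (D := [set y | f p - e < y])) => [n _|];
    [exact: lin_continuous|exact: open_gt].
have O0 : O !=set0.
  have : closure (W i)° p by rewrite rW.
  move=> /(_ [set n | f p - e < f n])[|q [Wq fq]]; last by exists q.
  by apply: open_nbhs_nbhs; split=> //=; rewrite ltrBlDr ltrDl.
have [r hr] := lat_cover (openI (open_interior (W i)) oO') O0; exists r => v x y Gx Gy xy.
have [g Gg [gr [/interior_subset Wg fg]]] := hr (pV y) v.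
have : in_window W v i (x + (g - y)).
  apply/(xy (g - y)); [exact: latB|by rewrite linearB|].
  by rewrite addrC subrK.
have xgy : pN (x + (g - y)) - v = (pN g - v) + (pN x - pN y).
  by rewrite linearD linearB/= addrCA addrAC.
rewrite /in_window xgy => Wxg.
have := pmax ((pN g - v) + (pN x - pN y)); rewrite inE => /(_ Wxg).
by rewrite linearD/= => h; move: fg => /=; lra.
Qed.

(** Agreement is symmetric, so the one-sided bound holds for each coordinate with both signs; [e] is
    chosen so that the coordinate errors add up to at most [d]. *)
Lemma agree_close (d : R) : 0 < d -> exists2 r : R, 0 < r &
  forall (v : N) x y, G x -> G y -> agree r (in_window W v) x y -> `|pN x - pN y| <= d.
Proof.
move=> d0; pose n := \dim {:N}; have [C C0 hC] := norm_le_coord N.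
pose e := d / (C * n%:R + 1).
have Cn0 : 0 < C * n%:R + 1 by rewrite ltr_wpDl// mulr_ge0.
have e0 : 0 < e by rewrite divr_gt0.
pose r j := sval (cid (agree_functional (coord (vbasis {:N}) j) e0)).
have rP j := svalP (cid (agree_functional (coord (vbasis {:N}) j) e0)).
exists (\big[Num.max/1]_(j < n) r j).
  by rewrite (lt_le_trans ltr01)// bigmax_ge_id.
move=> v x y Gx Gy xy.
have cj (j : 'I_n) : `|coord (vbasis {:N}) j (pN x - pN y)| <= e.
  have {}xy : agree (r j) (in_window W v) x y.
    by apply: agree_le xy; exact: le_bigmax.
  have h1 := rP j v x y Gx Gy xy; have h2 := rP j v y x Gy Gx (agree_sym xy).
  rewrite ler_norml h1 andbT lerNl; apply: le_trans h2.
  by rewrite -linearN opprB.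
apply: (le_trans (hC _)).
apply: (@le_trans _ _ (C * (n%:R * e))).
  rewrite ler_wpM2l//.
  have -> : n%:R * e = \sum_(j < n) e by rewrite sumr_const card_ord mulr_natl.
  by apply: ler_sum => j _.
have -> : d = e * (C * n%:R + 1) by rewrite /e divfK// gt_eqF.
by rewrite mulrA mulrC ler_pM2l// lerDl.
Qed.

Context (L : 'End(V)) (M : 'End(E)) (hM : scheme_extension L M) (eL : expansive L).

Let A : 'End(N) := restrict_end M (intl S).

Context (s0 : N).
Hypothesis AWW : constructable_from (shift_window (- s0) W) (image_window A W).

Lemma iter_lat k x : G x -> G (iter k M x).
Proof. by elim: k => //= k IH /IH; exact: (ext_lat hM). Qed.

Lemma iter_lat_surj k y : G y -> exists2 x, G x & y = iter k M x.
Proof.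
elim: k y => [|k IH] y Gy; first by exists y.
by have [z Gz ->] := ext_lat_surj hM Gy; have [x Gx ->] := IH z Gz; exists x.
Qed.

Lemma iter_pi_phys k x : pV (iter k M x) = iter k L (pV x).
Proof. by elim: k => //= k IH; rewrite (ext_pi_phys hM) IH. Qed.

Lemma iter_pi_intl k x : pN (iter k M x) = iter k A (pN x).
Proof. by elim: k => //= k IH; rewrite (ext_pi_intl hM) IH. Qed.

Section Orbit.
Context (v0 : N) (ns0 : nonsingular (shift_window v0 W)).

(** Inflation turns the parameter [v k] of [W] into [A (v k)] for [A(W)]; deriving [W - s0] from
    [A(W)] then amounts to the parameter [A (v k) - s0] for [W]. *)
Let v k := iter k (fun n => A n - s0) v0.

(* The inflated pattern after k steps, pulled back to the lattice. *)
Let Z k i x := in_window W (v k) i (iter k M x).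

Let c := sval (cid (constructable_determines (window_regclosed (ext_image_window hM hW)) AWW)).
Let cP := svalP (cid (constructable_determines (window_regclosed (ext_image_window hM hW)) AWW)).

Lemma orbit_nonsingular k : nonsingular (shift_window (v k) W).
Proof.
elim: k => [//|k IH].
have /cP[+ _] : nonsingular (shift_window (A (v k)) (image_window A W)).
  exact/(ext_nonsingular hM).
by rewrite shift_window_shift.
Qed.

(** Both levels are pulled back to the lattice, so the derivation radius [c] is measured after
    [k.+1] inflations. *)
Lemma orbit_step k x y : G x -> G y ->
  (forall h, G h -> `|iter k.+1 L (pV h)| <= c -> forall i, Z k i (x + h) <-> Z k i (y + h)) ->
  forall i, Z k.+1 i x <-> Z k.+1 i y.
Proof.
move=> Gx Gy xy i.
have nsA : nonsingular (shift_window (A (v k)) (image_window A W)).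
  by apply/(ext_nonsingular hM); exact: orbit_nonsingular.
have [_ /(_ i) d] := cP nsA.
have ZE z : Z k.+1 i z <->
    in_window (shift_window (- s0) W) (A (v k)) i (iter k.+1 M z).
  by rewrite in_window_shift.
rewrite !ZE; apply: d; [exact: iter_lat|exact: iter_lat|].
move=> h' Gh' hc j; have [h Gh hh'] := iter_lat_surj k.+1 Gh'.
move: hc; rewrite hh' iter_pi_phys -!iter_lfunD /= => hc.
by rewrite !(ext_in_window hM); exact: xy.
Qed.

Let L0 : lker L == 0%VS. Proof. exact/lker0P/(ext_phys_inj hM). Qed.

Let iterLK k : cancel (iter k L) (iter k L^-1%VF).
Proof. by elim: k => //= k IH u; rewrite iterSr lker0_lfunK// IH. Qed.

Let kappa := sval (cid (expansive_summable L0 eL)).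

Let kappa_ge0 k : 0 <= kappa k.
Proof. by rewrite /kappa; case: cid => ? /= []. Qed.

Let kappaP k u : `|u| <= kappa k * `|iter k L u|.
Proof. by rewrite -{1}(iterLK k u) /kappa; case: cid => ? /= []. Qed.

Let kappa_sum : exists C, forall m, \sum_(k < m) kappa k <= C.
Proof. by rewrite /kappa; case: cid => ? /= []. Qed.

Let c' := Num.max 0 c.
Let c'0 : 0 <= c'. Proof. by rewrite le_max lexx. Qed.

Lemma orbit_agree_step k r x y : G x -> G y ->
  agree (r + kappa k.+1 * c') (Z k) x y -> agree r (Z k.+1) x y.
Proof.
move=> Gx Gy xy h Gh hr i.
apply: orbit_step; [exact: latD|exact: latD|] => h' Gh' hc j.
rewrite -!addrA; apply: xy; first exact: latD.
rewrite linearD/= (le_trans (ler_normD _ _))// lerD// (le_trans (kappaP k.+1 _))//.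
by rewrite ler_wpM2l// (le_trans hc)// le_max lexx orbT.
Qed.

(** The step to level [k] costs [kappa k * c'] of radius. These losses are summable, so one [r0]
    covers all levels. *)
Lemma orbit_determined : exists r0 : R, forall r k x y, G x -> G y ->
  agree (r + r0) (Z 0) x y -> agree r (Z k) x y.
Proof.
have [C hC] := kappa_sum; exists (C * c') => r k x y Gx Gy xy.
have {}xy : agree (r + \sum_(j < k.+1) kappa j * c') (Z 0) x y.
  by apply: agree_le xy; rewrite lerD2l -mulr_suml ler_wpM2r.
elim: k r x y Gx Gy xy => [|k IH] r x y Gx Gy xy.
  by apply: agree_le xy; rewrite lerDl sumr_ge0// => j _; exact: mulr_ge0.
apply: orbit_agree_step => //; apply: IH => //.
by apply: agree_le xy; rewrite [in leRHS]big_ord_recr/= -addrA lerD2l addrC.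
Qed.

(** The ball of radius [kappa k * r], inflated [k] times, covers the ball of radius [r]. *)
Lemma orbit_agree_iter k r x y : G x -> G y ->
  agree (kappa k * r) (Z k) x y -> agree r (in_window W (v k)) (iter k M x) (iter k M y).
Proof.
move=> Gx Gy xy h' Gh' hr i; have [h Gh hh'] := iter_lat_surj k Gh'.
rewrite hh' -!iter_lfunD; apply: xy => //.
by rewrite (le_trans (kappaP k _))// ler_wpM2l// -iter_pi_phys -hh'.
Qed.

(* Lattice vectors of small internal part are return vectors of the initial
   pattern on a fixed ball, hence, by expansion, of the k-th one on ever larger
   balls; this forces A^k to shrink them. *)
Lemma extension_contractive : contractive A.
Proof.
apply: iter_small_contractive => d d0.
have [r0 hr0] := orbit_determined.
have [e e0 he] := in_window_stable hW (1 + r0) ns0.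
have d'0 : 0 < d * e / 4 by rewrite !mulr_gt0.
have [r r_gt0 hr] := agree_close d'0; have [C hC] := kappa_sum.
have r0' : 0 < r^-1 by rewrite invr_gt0.
(* With [kappa k] at most [r^-1], agreement on the unit ball at level [k] inflates to agreement on
   radius [r]. *)
have [k hk] := summable_small hC r0'; exists k.
have small g : G g -> `|pN g| < e -> `|iter k A (pN g)| <= d * e / 4.
  move=> Gg ge.
  have G0 := lat0 S.
  have a0 : agree (1 + r0) (Z 0) g 0.
    move=> h Gh hr1 i; rewrite add0r /Z /=.
    by rewrite -(he h (pN g) i Gh hr1 ge) /in_window linearD/= (addrC (pN g)) addrAC.
  have a1 := hr0 1 k g 0 Gg G0 a0.
  have a2 : agree r (in_window W (v k)) (iter k M g) (iter k M 0).
    apply: orbit_agree_iter => //; apply: agree_le a1.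
    by rewrite -(mulVf (lt0r_neq0 r_gt0)) ler_pM2r.
  have := hr _ _ _ (iter_lat k Gg) (iter_lat k G0) a2.
  by rewrite !iter_pi_intl -iter_lfunB linear0 subr0.
move=> x; have [->|x0] := eqVneq x 0.
  have := iter_lfunZ A k 0 0; rewrite !scale0r => ->.
  by rewrite !normr0 mulr0.
have xn0 : 0 < `|x| by rewrite normr_gt0.
(* Scale [x] to length [e / 2] and approximate it by some [pN g]. The tolerance [f] keeps [pN g]
   shorter than [e] and the [k]-th image of the error at most [d * e / 4]. *)
pose a := e / 2 / `|x|; have a0 : 0 < a by rewrite !divr_gt0.
have [D D0 hD] := iter_bounded A k.
pose f := Num.min (e / 2) (d * e / 4 / D).
have f0 : 0 < f by rewrite lt_min !divr_gt0// !mulr_gt0.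
have [g Gg gx] := lat_near (a *: x) f0.
have an : `|a *: x| = e / 2.
  by rewrite normrZ gtr0_norm// /a divfK// gt_eqF.
have ge : `|pN g| < e.
  rewrite -[pN g](subrK (a *: x)) (le_lt_trans (ler_normD _ _))// an.
  by move: gx; rewrite lt_min => /andP[gx _]; lra.
have h1 : `|iter k A (a *: x)| <= d * e / 2.
  have -> : a *: x = pN g - (pN g - a *: x) by rewrite subKr.
  rewrite iter_lfunB (le_trans (ler_normB _ _))//.
  have h2 : `|iter k A (pN g - a *: x)| <= d * e / 4.
    rewrite (le_trans (hD _))// mulrC -ler_pdivlMr// ltW//.
    by move: gx; rewrite lt_min => /andP[_].
  have := small g Gg ge; lra.
move: h1; rewrite iter_lfunZ normrZ (gtr0_norm a0) -ler_pdivlMl//.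
move=> /le_trans; apply; rewrite le_eqVlt; apply/orP; left; apply/eqP.
by rewrite /a; field; rewrite !gt_eqF.
Qed.

(* Two points whose level-k patterns agree on a large ball are close in the
   internal space, so only finitely many pairs of initial patches occur at such
   points.  These sets of pairs increase with k, hence stabilise, and stability
   says that level k+1 determines level k. *)
Lemma orbit_recognizable : exists k r, forall i, determines r (Z k.+1) (Z k i).
Proof.
have [r0 hr0] := orbit_determined.
have [w w0 Ww] := finite_family_bounded (window_bounded hW).
have [rho hrho] := window_dense hW.
have rho0 : 0 <= rho.
  by have [g _ [gr _]] := hrho 0 0; exact: le_trans gr.
(* Initial agreement on radius [r1] gives agreement on radius [rho] at every level; the extra 1 in
   [B] leaves room for a partner at internal distance 1 from a window point. *)
pose r1 := rho + r0; pose B := w + `|v0| + 1.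
pose F := [set h | [/\ G h, `|pV h| <= r1 & `|pN h| <= w + `|v0| + B]].
have [hs hsF] : exists hs : seq E, F = [set` hs].
  by apply/finite_seqP; exact: lat_locally_finite.
pose T : finType := {ffun 'I_(size hs) * 'I_l -> bool}.
(* The code records the initial patch of radius [r1]: from a point with internal part at most [B],
   no lattice vector of that radius outside [F] leads into the window. *)
pose code (x : E) : T := [ffun p : 'I_(size hs) * 'I_l => `[< Z 0 p.2 (x + hs`_p.1) >]].
have tri (a b : N) : `|b| <= `|a + b| + `|a|.
  by rewrite -{1}(addKr a b) addrC (le_trans (ler_normB _ _)).
have Zb i x : Z 0 i x -> `|pN x| <= w + `|v0|.
  rewrite /Z /in_window /= => /Ww h.
  by rewrite -(subrK v0 (pN x)) (le_trans (ler_normD _ _))// lerD2r.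
have codeP x y : `|pN x| <= B -> `|pN y| <= B -> code x = code y -> agree r1 (Z 0) x y.
  move=> xB yB xy h Gh hr i; have [hF|hF] := pselect (F h).
    have hin : h \in hs by move: hF; rewrite hsF.
    have hlt : (index h hs < size hs)%N by rewrite index_mem.
    have := congr1 (fun f : T => f (Ordinal hlt, i)) xy.
    by rewrite !ffunE /= => e; have := asbool_eq_equiv e; rewrite nth_index.
  have no x' : `|pN x'| <= B -> ~ Z 0 i (x' + h).
    move=> x'B /Zb; rewrite linearD/= => h1; apply: hF; split=> //.
    by rewrite (le_trans (tri (pN x') _))// lerD.
  by split=> h'; exfalso; [exact: (no x)|exact: (no y)].
(* Some pair of points with codes [ab] agrees at level [k] on radius [m]; [Sk k] collects the code
   pairs realised for every [m]. *)
pose bad k (m : R) (ab : T * T) := exists x y, [/\ G x /\ G y, `|pN x| <= B /\ `|pN y| <= B,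
  code x = ab.1 /\ code y = ab.2 & agree m (Z k) x y].
pose Sk k : {set T * T} := [set ab | `[< forall m : R, bad k m ab >]]%SET.
have [K SK] : exists K, Sk K = Sk K.+1.
  apply: increasing_setsystem_stable => k; apply/fintype.subsetP => ab.
  rewrite !inE => /asboolP hab; apply/asboolP => m.
  have [x [y [[Gx Gy] xyB cxy xy]]] := hab (m + kappa k.+1 * c').
  by exists x, y; split=> //; exact: orbit_agree_step.
have [CA CA0 hCA] := iter_bounded (restrict_end M (intl S))^-1%VF K.+1.
have A0 : lker A == 0%VS by apply/lker0P; exact: (ext_intl_inj hM).
have iterAK n : iter K.+1 A^-1%VF (iter K.+1 A n) = n.
  by elim: K.+1 n => //= k IH n; rewrite -iterS iterSr -iterS lker0_lfunK// IH.
have d0 : 0 < CA^-1 by rewrite invr_gt0.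
have [r2 r20 hr2] := agree_close d0.
have close x y : G x -> G y -> agree (kappa K.+1 * r2) (Z K.+1) x y -> `|pN x - pN y| <= 1.
  move=> Gx Gy xy.
  have h1 := hr2 _ _ _ (iter_lat K.+1 Gx) (iter_lat K.+1 Gy) (orbit_agree_iter Gx Gy xy).
  rewrite -(iterAK (pN x - pN y)) (le_trans (hCA _))//.
  by rewrite iter_lfunB -!iter_pi_intl mulrC -ler_pdivlMr// div1r.
(* A code pair outside [Sk K.+1] fails at some radius, and [m] is the largest of finitely many such
   radii. *)
have [m hm] : exists m : R, forall ab, bad K.+1 m ab -> forall m', bad K m' ab.
  have /choice[mm hmm] (ab : T * T) : exists m : R, bad K.+1 m ab -> forall m', bad K m' ab.
    have [abS|nabS] := boolP (ab \in Sk K).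
      by exists 0 => _; move: abS; rewrite inE => /asboolP.
    have : ~ forall m : R, bad K.+1 m ab.
      by move=> h; move/negP: nabS; apply; rewrite SK inE; exact/asboolP.
    by move=> /existsNP[m nm]; exists m.
  exists (\big[Num.max/0]_ab mm ab) => ab [x [y [Gxy xyB cxy xy]]].
  apply: hmm; exists x, y; split=> //; apply: agree_le xy; exact: le_bigmax.
pose r := Num.max (m + rho) (kappa K.+1 * r2).
exists K, r => i x y Gx Gy xy.
have xy1 : `|pN x - pN y| <= 1.
  by apply: close => //; apply: agree_le xy; rewrite le_max lexx orbT.
(* [x] may lie far from the window, so the comparison is moved to a nearby pattern point [p] and its
   partner [q]. *)
have [p Gp [px [j pZ]]] := hrho (pV x) v0.
have Gg : G (p - x) by exact: latB.
have gr : `|pV (p - x)| <= rho by rewrite linearB.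
pose q := y + (p - x); have Gq : G q by exact: latD.
have pE : x + (p - x) = p by rewrite addrC subrK.
have pB : `|pN p| <= w + `|v0| by exact: (Zb j).
have qB : `|pN q| <= B.
  have -> : pN q = pN p - (pN x - pN y).
    by rewrite /q linearD linearB/= opprB addrCA.
  by rewrite (le_trans (ler_normB _ _))// lerD.
have pB' : `|pN p| <= B by rewrite (le_trans pB)// lerDl.
(* The codes of [p] and [q] are also realised by points [x'], [y'] that agree at level [K]; equal
   codes carry this agreement back to [p] and [q]. *)
have [|x' [y' [[Gx' Gy'] [x'B y'B] [/= cx cy] xy']]] := hm (code p, code q) _ rho.
  exists p, q; split=> //; rewrite -{1}pE; apply: agree_shift => //.
  by apply: agree_le xy; rewrite le_max lerD2l gr.
have ap : agree rho (Z K) p x'.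
  by apply: hr0 => //; apply: codeP.
have aq : agree rho (Z K) q y'.
  by apply: hr0 => //; apply: codeP.
have Gg' : G (- (p - x)) by exact: latN.
have gr' : `|pV (- (p - x))| <= rho by rewrite linearN normrN.
have := ap _ Gg' gr' i; have := aq _ Gg' gr' i; have := xy' _ Gg' gr' i.
have -> : p - (p - x) = x by rewrite subKr.
have -> : q - (p - x) = y by rewrite /q addrK.
by move=> -> <- ->.
Qed.

(** Read through the [k.+1]-st power of [M], levels [k.+1] and [k] are the windows [W - s0] and
    [A(W)] at the common parameter [A (v k)]. Recognizability at one level thus inverts the original
    derivation. *)
Lemma constructable_from_reverse :
  constructable_from (image_window A W) (shift_window (- s0) W).
Proof.
have [k [r hr]] := orbit_recognizable.
have hAW := ext_image_window hM hW; have hW0 := shift_is_window (- s0) hW.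
have nsW0 : nonsingular (shift_window (A (v k)) (shift_window (- s0) W)).
  by rewrite shift_window_shift; exact: (orbit_nonsingular k.+1).
have [C C0 hC] := iter_bounded L k.+1.
apply: (sandwich_constructable (s := A (v k)) (D := in_window (image_window A W) (A (v k))) _ nsW0).
- exact: window_regclosed.
- exact: window_bounded.
- by case: hW0.
- exact: window_regclosed.
- exact: window_bounded.
- move=> j; exists (C * r) => x y Gx Gy xy.
  have [x' Gx' xx'] := iter_lat_surj k.+1 Gx; have [y' Gy' yy'] := iter_lat_surj k.+1 Gy.
  move: xy; rewrite xx' yy' => xy; rewrite /= !(ext_in_window hM); apply: hr => //.
  move=> h Gh hr' i; have := xy (iter k.+1 M h) (iter_lat k.+1 Gh).
  rewrite iter_pi_phys -!iter_lfunD => /(_ _ i); rewrite !in_window_shift; apply.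
  by rewrite (le_trans (hC _))// ler_pM2l.
- by move=> j g _; exact: interior_subset.
- by [].
Qed.

End Orbit.
End Recurrence.

Theorem theorem3p1 (R : realType) (E : normedVectType R)
    (S : cut_project_scheme E) (l : nat)
    (W : 'I_l -> set (subvs_of (intl S))) (hW : is_window W)
    (L : 'End(subvs_of (phys S))) (hL : bijective L) :
  ((forall P, cp_hull W P -> LSub L P) <->
     exists M : 'End(E),
       scheme_extension L M /\
       exists s, mutually_constructable (shift_window (- s) W)
                   (image_window (restrict_end M (intl S)) W)) /\
  (expansive L ->
     (forall M : 'End(E),
        scheme_extension L M ->
        (exists s, mutually_constructable (shift_window (- s) W)
                     (image_window (restrict_end M (intl S)) W)) ->
        contractive (restrict_end M (intl S))) /\
     ((forall P, cp_hull W P -> LSub L P) <->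
        exists M : 'End(E),
          scheme_extension L M /\
          exists s, constructable_from (shift_window (- s) W)
                      (image_window (restrict_end M (intl S)) W))).
Proof.
have [s ns] := nonsingular_exists (window_regclosed hW).
have equiv : (forall P, cp_hull W P -> LSub L P) <->
    exists M : 'End(E), scheme_extension L M /\
      exists s, mutually_constructable (shift_window (- s) W)
                  (image_window (restrict_end M (intl S)) W).
  split=> [hP|[M [hM [s0 WAW]]] P]; last exact: mutually_constructable_LSub WAW.
  (* The assumption on the hull is applied to the non-singular pattern itself. *)
  apply: (LSub_mutually_constructable hW hL ns); apply: hP; exists s => //.
  by split; [exact: cp_delone|exact: LI_from_refl].
split=> // eL; split=> [M hM [s0 WAW]|].
  have cW : constructable_from (shift_window (- s0) W)
      (image_window (restrict_end M (intl S)) W) by rewrite /constructable_from WAW.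
  exact: (extension_contractive hW hM eL cW ns).
rewrite equiv; split=> -[M [hM [s0 WAW]]]; exists M; split=> //; exists s0.
  by rewrite /constructable_from WAW.
by apply/seteqP; split=> //; exact: (constructable_from_reverse hW hM eL WAW ns).
Qed.
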